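(* Let $n\ge 1$ and let $\alpha_1,\alpha_2,\gamma\in\mathbb{C}$ with $\delta:=\alpha_1\alpha_2-\gamma^2\neq 0$. Let $p\ge 0$ and, for $t=0,1,\dots,p$, let $$f_t(A,B)=\prod_{r=1}^{R_t}A^{k_{t,r}}B^{l_{t,r}}$$ (ordered products, $R_t\ge 0$, $k_{t,r},l_{t,r}$ non-negative integers). Put $$G_0(A,B):=\prod_{1\le u\le p}\operatorname{Tr}f_u(A,B),\qquad G_t(A,B):=\prod_{1\le u\le p,\ u\ne t}\operatorname{Tr}f_u(A,B)\quad(1\le t\le p).$$ Then, with $\langle\cdot\rangle_C$ the Gaussian complex-matrix expectation value and with $G_t,f_t$ evaluated at $(Z,Z^\dagger)$, the following two identities hold: $$\begin{aligned} &\alpha_1\langle G_0\operatorname{Tr}(Zf_0)\rangle_C+\gamma\langle G_0\operatorname{Tr}(Z^\dagger f_0)\rangle_C\\ &=\sum_{r=1}^{R_0}\sum_{j=0}^{k_{0,r}-1}\Big\langle G_0\,\operatorname{Tr}\Big(\Big(\prod_{u=1}^{r-1}Z^{k_{0,u}}{Z^\dagger}^{l_{0,u}}\Big)Z^{j}\Big)\operatorname{Tr}\Big(Z^{k_{0,r}-j-1}{Z^\dagger}^{l_{0,r}}\prod_{u=r+1}^{R_0}Z^{k_{0,u}}{Z^\dagger}^{l_{0,u}}\Big)\Big\rangle_C\\ &\quad+\sum_{t=1}^{p}\sum_{r=1}^{R_t}\sum_{j=0}^{k_{t,r}-1}\Big\langle G_t\,\operatorname{Tr}\Big(\Big(\prod_{u=1}^{r-1}Z^{k_{t,u}}{Z^\dagger}^{l_{t,u}}\Big)Z^{j}\,f_0\,Z^{k_{t,r}-j-1}{Z^\dagger}^{l_{t,r}}\prod_{u=r+1}^{R_t}Z^{k_{t,u}}{Z^\dagger}^{l_{t,u}}\Big)\Big\rangle_C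 \end{aligned}$$ and $$\begin{aligned} &\alpha_2\langle G_0\operatorname{Tr}(Z^\dagger f_0)\rangle_C+\gamma\langle G_0\operatorname{Tr}(Zf_0)\rangle_C\\ &=\sum_{r=1}^{R_0}\sum_{j=0}^{l_{0,r}-1}\Big\langle G_0\,\operatorname{Tr}\Big(\Big(\prod_{u=1}^{r-1}Z^{k_{0,u}}{Z^\dagger}^{l_{0,u}}\Big)Z^{k_{0,r}}{Z^\dagger}^{j}\Big)\operatorname{Tr}\Big({Z^\dagger}^{l_{0,r}-j-1}\prod_{u=r+1}^{R_0}Z^{k_{0,u}}{Z^\dagger}^{l_{0,u}}\Big)\Big\rangle_C\\ &\quad+\sum_{t=1}^{p}\sum_{r=1}^{R_t}\sum_{j=0}^{l_{t,r}-1}\Big\langle G_t\,\operatorname{Tr}\Big(\Big(\prod_{u=1}^{r-1}Z^{k_{t,u}}{Z^\dagger}^{l_{t,u}}\Big)Z^{k_{t,r}}{Z^\dagger}^{j}\,f_0\,{Z^\dagger}^{l_{t,r}-j-1}\prod_{u=r+1}^{R_t}Z^{k_{t,u}}{Z^\dagger}^{l_{t,u}}\Big)\Big\rangle_C. \end{aligned}$$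
   Context: Let $\mathrm{Mat}_n(\mathbb{C})$ be the space of all $n\times n$ complex matrices with Lebesgue measure $dZ=\prod_{i,j}d\,\mathrm{Re}Z_{ij}\,d\,\mathrm{Im}Z_{ij}$. For a function $F(A,B)$ of two $n\times n$ matrices which is a polynomial in traces of words in $A,B$, $$\langle F\rangle_C:=\frac{\int_{\mathrm{Mat}_n(\mathbb{C})}dZ\,F(Z,Z^\dagger)\,e^{-\operatorname{Tr}(\frac{\alpha_1}{2}Z^2+\frac{\alpha_2}{2}{Z^\dagger}^2+\gamma ZZ^\dagger)}}{\int_{\mathrm{Mat}_n(\mathbb{C})}dZ\,e^{-\operatorname{Tr}(\frac{\alpha_1}{2}Z^2+\frac{\alpha_2}{2}{Z^\dagger}^2+\gamma ZZ^\dagger)}}$$ for those $(\alpha_1,\alpha_2,\gamma)$ for which the integrals converge absolutely, i.e. $\mathrm{Re}(\alpha_1e^{i\theta}+\alpha_2e^{-i\theta}+2\gamma)>0$ for all $\theta\in\mathbb{R}$. There $\langle F\rangle_C$ is a polynomial in $\alpha_1/\delta,\alpha_2/\delta,\gamma/\delta$ (with $\delta=\alpha_1\alpha_2-\gamma^2$), and it is extended by this polynomial expression to all $(\alpha_1,\alpha_2,\gamma)\in\mathbb{C}^3$ with $\delta\ne0$. Empty products of matrices are the identity matrix, and empty products of scalars are $1$. *)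

(* Defs.v *)
From HB Require Import structures.
From mathcomp Require Import all_boot all_order all_algebra.
From mathcomp Require Import spectral.
From mathcomp Require Import all_classical all_reals all_analysis.
From mathcomp Require Export complex.
From mathcomp Require mpoly.
Import (canonicals) mpoly.

Set Implicit Arguments.
Unset Strict Implicit.
Unset Printing Implicit Defensive.

Import Order.TTheory GRing.Theory Num.Theory.
Import numFieldNormedType.Exports.

Local Open Scope classical_set_scope.
Local Open Scope ring_scope.
Local Open Scope sesquilinear_scope.
Local Open Scope complex_scope.

Section lebesgue_tuple.
Context (R : realType).
Local Notation T := (measurableTypeR R).

Definition tuple_cons m (x : T * m.-tuple T) : m.+1.-tuple T :=
  [the m.+1.-tuple T of x.1 :: x.2].

Lemma measurable_tuple_cons m : measurable_fun [set: T * m.-tuple T] (@tuple_cons m).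
Proof. exact: measurable_cons. Qed.

Section cons_measure.
Context m (mu : {sigma_finite_measure set (m.-tuple T) -> \bar R}).

Definition cons_measure : set (m.+1.-tuple T) -> \bar R :=
  pushforward (@lebesgue_measure R \x mu)%E (@tuple_cons m).

Let cons_measure0 : cons_measure set0 = 0%E.
Proof. by rewrite /cons_measure /pushforward preimage_set0 measure0. Qed.

Let cons_measure_ge0 A : (0 <= cons_measure A)%E.
Proof. by rewrite /cons_measure /pushforward measure_ge0. Qed.

Let cons_measure_sigma_additive : semi_sigma_additive cons_measure.
Proof.
move=> F mF tF mUF; rewrite /cons_measure /pushforward preimage_bigcup.
have mp A : measurable A -> measurable (@tuple_cons m @^-1` A).
  by move=> mA; rewrite -[X in measurable X]setTI; exact: measurable_tuple_cons.
apply: measure_semi_sigma_additive.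
- by move=> i; exact: mp.
- apply/trivIsetP => /= i j _ _ ij; rewrite -preimage_setI.
  by move/trivIsetP : tF => /(_ _ _ _ _ ij) ->//; rewrite preimage_set0.
- by rewrite -preimage_bigcup; exact: mp.
Qed.

HB.instance Definition _ := isMeasure.Build _ _ _ cons_measure
  cons_measure0 cons_measure_ge0 cons_measure_sigma_additive.

Let cons_measure_sigma_finite : sigma_finite setT cons_measure.
Proof.
have /sigma_finiteP[F [TF ndF Foo]] := sigma_finiteT (@lebesgue_measure R).
have /sigma_finiteP[G [TG ndG Goo]] := sigma_finiteT mu.
pose g (t : m.+1.-tuple T) : T * m.-tuple T := (thead t, [tuple of behead t]).
have mg : measurable_fun setT g.
  apply/measurable_fun_pairP; split; first exact: measurable_tnth.
  exact: measurable_behead.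
have gK : cancel (@tuple_cons m) g.
  by case=> x t; congr pair; apply/val_inj.
exists (fun i => g @^-1` (F i `*` G i)).
  rewrite -preimage_bigcup -(preimage_setT g) -setXTT TF TG; congr preimage.
  rewrite predeqE => -[x y]; split.
    move=> [/= [i _ Fix] [j _ Gjy]]; exists (maxn i j) => //; split.
    - by move: x Fix; exact/subsetPset/ndF/leq_maxl.
    - by move: y Gjy; exact/subsetPset/ndG/leq_maxr.
  by move=> [i _ []/= ? ?]; split; exists i.
move=> i; have [mF Fioo] := Foo i; have [mG Gioo] := Goo i; split.
  by rewrite -[X in measurable X]setTI; apply: mg => //; exact: measurableX.
rewrite /cons_measure /pushforward -comp_preimage.
rewrite (_ : g \o _ = id) ?preimage_id; last by apply/funext => x /=; rewrite gK.
by rewrite product_measure1E// lte_mul_pinfty// ge0_fin_numE.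
Qed.

HB.instance Definition _ := Measure_isSigmaFinite.Build _ _ _ cons_measure
  cons_measure_sigma_finite.

End cons_measure.

(* Lebesgue measure on R^m, as the m-fold product of the one on R *)
Fixpoint lebesgue_tuple m : {sigma_finite_measure set (m.-tuple T) -> \bar R} :=
  match m with
  | 0 => \d_ ([tuple] : 0.-tuple T)
  | m'.+1 => cons_measure (lebesgue_tuple m')
  end.

End lebesgue_tuple.

Section gaussian.
Context {R : realType}.
Local Notation C := R[i].
Local Notation T := (measurableTypeR R).

Definition cexp (z : C) : C :=
  (expR (complex.Re z))%:C * (cos (complex.Im z) +i* sin (complex.Im z)).

(* the complex matrix with given real and imaginary parts of its entries *)
Definition mx_of_tuple n (x : (n * n + n * n).-tuple T) : 'M[C]_n :=
  \matrix_(i, j) (tnth x (lshift (n * n) (mxvec_index i j)) +i*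
                  tnth x (rshift (n * n) (mxvec_index i j))).

Definition mx_integral n (f : 'M[C]_n -> C) : C :=
  (\int[lebesgue_tuple R (n * n + n * n)]_x complex.Re (f (mx_of_tuple x))) +i*
  (\int[lebesgue_tuple R (n * n + n * n)]_x complex.Im (f (mx_of_tuple x))).

Definition gauss_weight n (a1 a2 g : C) (Z : 'M[C]_n) : C :=
  cexp (- \tr (a1 / 2 *: Z ^+ 2 + a2 / 2 *: (Z ^t*) ^+ 2 + g *: (Z * Z ^t*))).

Definition gauss_ratio n (F : 'M[C]_n -> 'M[C]_n -> C) (a1 a2 g : C) : C :=
  mx_integral (fun Z => F Z (Z ^t*) * gauss_weight a1 a2 g Z) /
  mx_integral (@gauss_weight n a1 a2 g).

Definition gauss_domain (a1 a2 g : C) : Prop :=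
  forall theta : R,
    0 < complex.Re (a1 * cexp (0 +i* theta) + a2 * cexp (0 -i* theta) + 2 * g).

Definition eval_over_delta (P : mpoly.mpoly 3 C) (a1 a2 g : C) : C :=
  let d := a1 * a2 - g ^+ 2 in
  mpoly.meval (tnth [tuple a1 / d; a2 / d; g / d]) P.

(* P is unique when it exists, since (a1, a2, g) |-> (a1/d, a2/d, g/d) maps
   gauss_domain onto a set with nonempty interior *)
Definition gauss_polynomial n (F : 'M[C]_n -> 'M[C]_n -> C) : mpoly.mpoly 3 C :=
  xget (0 : mpoly.mpoly 3 C) [set P | forall a1 a2 g, gauss_domain a1 a2 g ->
                  gauss_ratio F a1 a2 g = eval_over_delta P a1 a2 g].

Definition gauss_mean n (a1 a2 g : C) (F : 'M[C]_n -> 'M[C]_n -> C) : C :=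
  eval_over_delta (gauss_polynomial F) a1 a2 g.

End gaussian.

Definition word {K : pzRingType} n (k l : nat -> nat) (a b : nat)
    (A B : 'M[K]_n) : 'M[K]_n :=
  \prod_(a <= u < b) (A ^+ k u * B ^+ l u).

(* Main.v *)
From HB Require Import structures.
Require Import Defs.
From mathcomp Require Import all_boot all_order all_algebra.
From mathcomp Require Import all_classical all_reals all_analysis.
From mathcomp Require Import measurable_realfun spectral.
From mathcomp Require Import ring lra zify.
From mathcomp Require mpoly.
Import (canonicals) mpoly.

(** Integrating by parts in each real coordinate of [Z] gives, for every
polynomial [P] in the entries [Z_ij] and [W_ij] of [Z] and its adjoint [W],
  a1 <P Z_ji> + g <P W_ji> = <dP/dZ_ij>,   a2 <P W_ji> + g <P Z_ji> = <dP/dW_ij>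
on the convergence domain, which is the set where |a1 + conj a2| < 2 Re g.
Solving this 2 x 2 system lowers the degree, so all moments are polynomials in
a1/delta, a2/delta, g/delta times the normalization [D].  The same equations
in degree two say that [D ^ 2 * delta ^ (n ^ 2)] has zero derivative along the
segment from (0, 0, 1), hence [D] and [delta] never vanish.  The polynomials
are determined by their values on the domain (restrict to a segment), so the
equations persist for all delta != 0; summing them over i, j with
P = G0 * (f0)_ij and applying the Leibniz rule gives the theorem. *)

Set Implicit Arguments.
Unset Strict Implicit.
Unset Printing Implicit Defensive.

Import Order.TTheory GRing.Theory Num.Theory.
Import numFieldNormedType.Exports.

Local Open Scope classical_set_scope.
Local Open Scope ring_scope.
Local Open Scope sesquilinear_scope.
Local Open Scope complex_scope.

(** The mean is defined by choosing a polynomial, so existence and uniqueness of that polynomial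
    both have to be settled before an identity can leave the convergence domain. For complex
    parameters the weight oscillates, so positivity of the integrand says nothing about [D]; this is
    why its nonvanishing needs a differential equation. The square in [D ^ 2] avoids a branch of the
    root: [D] is a constant times the power -n^2/2 of delta. The entries of Z and W are independent
    polynomial variables, evaluated at complex linear forms in 2 n^2 real coordinates.
    Differentiation in one of them is therefore a Wirtinger operator, a complex combination of real
    partial derivatives. All integrability comes from one kind of majorant, a multiple of a product
    of centred normal densities. The coefficients a1, a2, g are not polynomials in a1/delta,
    a2/delta, g/delta; an identity becomes polynomial in these after division by delta, because
    1/delta = (a1/delta)(a2/delta) - (g/delta)^2. *)

Local Notation Re := complex.Re.
Local Notation Im := complex.Im.
Local Notation normc := Normc.normc.
Local Notation var i := (mpoly.mpolyX _ (mpoly.mnm1 i)).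

(** * Integration over tuples *)

Section tuple_integration.
Context {R : realType}.
Local Notation T := (measurableTypeR R).
Local Notation mu := (@lebesgue_measure R).
Implicit Types (m : nat) (s : R).

Lemma ge0_integral_lebesgue_tupleS m (f : m.+1.-tuple T -> \bar R) :
  measurable_fun [set: m.+1.-tuple T] f -> (forall x, 0 <= f x)%E ->
  (\int[lebesgue_tuple R m.+1]_x f x =
   \int[mu \x lebesgue_tuple R m]_z f (tuple_cons z))%E.
Proof.
move=> mf f0.
have mc := @measurable_tuple_cons R m.
by rewrite /= (@ge0_integral_pushforward _ _ _ _ R _ mc (mu \x lebesgue_tuple R m)%E setT f).
Qed.

Lemma integral_lebesgue_tupleS m (f : m.+1.-tuple T -> \bar R) :
  (lebesgue_tuple R m.+1).-integrable setT f ->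
  (mu \x lebesgue_tuple R m)%E.-integrable setT (f \o @tuple_cons R m) /\
  (\int[lebesgue_tuple R m.+1]_x f x =
   \int[mu \x lebesgue_tuple R m]_z f (tuple_cons z))%E.
Proof.
move=> fi; have /integrableP[mf foo] := fi.
have mc := @measurable_tuple_cons R m.
have ii : (mu \x lebesgue_tuple R m)%E.-integrable setT (f \o @tuple_cons R m).
  apply/integrableP; split; first exact: measurableT_comp.
  rewrite -(ge0_integral_lebesgue_tupleS (f := fun x => `|f x|%E))//.
  exact: measurableT_comp.
split=> //.
by rewrite /= (@integral_pushforward _ _ _ _ R _ mc (mu \x lebesgue_tuple R m)%E setT f).
Qed.

(** The common majorant: integrands below are bounded by a constant times this product of centred
    normal densities, which has total mass 1. *)
Definition gprod m s (x : m.-tuple T) : R :=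
  \prod_(i < m) normal_pdf 0 s (tnth x i).

Lemma gprod_ge0 m s (x : m.-tuple T) : 0 <= gprod s x.
Proof. by apply: prodr_ge0 => i _; exact: normal_pdf_ge0. Qed.

Lemma gprod_cons m s (z : T * m.-tuple T) :
  gprod s (tuple_cons z) = normal_pdf 0 s z.1 * gprod s z.2.
Proof.
rewrite /gprod big_ord_recl /=; congr (_ * _).
by apply: eq_bigr => i _; rewrite !(tnth_nth 0).
Qed.

Lemma measurable_gprod m s : measurable_fun [set: m.-tuple T] (@gprod m s).
Proof.
apply: measurable_prod => i _.
by apply: measurableT_comp; [exact: measurable_normal_pdf|exact: measurable_tnth].
Qed.

Lemma integral_gprod m s :
  (\int[lebesgue_tuple R m]_x (gprod s x)%:E = 1)%E.
Proof.
elim: m => [|m IH].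
  rewrite /= integral_dirac //=.
    by rewrite /gprod big_ord0 diracT mul1e.
  by apply/measurable_EFinP; exact: measurable_gprod.
rewrite ge0_integral_lebesgue_tupleS; last 2 first.
- by apply/measurable_EFinP; exact: measurable_gprod.
- by move=> x; rewrite lee_fin gprod_ge0.
under eq_integral do rewrite gprod_cons.
have mp : measurable_fun setT
    (fun z : T * m.-tuple T => (normal_pdf 0 s z.1 * gprod s z.2)%:E).
  apply/measurable_EFinP; apply: measurable_funM; apply: measurableT_comp => //.
    exact: measurable_normal_pdf.
  exact: measurable_gprod.
rewrite fubini_tonelli1//=; last first.
  by move=> z; rewrite lee_fin mulr_ge0 ?normal_pdf_ge0 ?gprod_ge0.
rewrite /fubini_F /=.
under eq_integral => x _.
  under eq_integral do rewrite EFinM.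
  rewrite ge0_integralZl ?lee_fin ?normal_pdf_ge0//; last 2 first.
  - by apply/measurable_EFinP; exact: measurable_gprod.
  - by move=> t _; rewrite lee_fin gprod_ge0.
  rewrite IH mule1.
  over.
exact: integral_normal_pdf.
Qed.

Lemma integrable_gprod m s :
  (lebesgue_tuple R m).-integrable setT (EFin \o @gprod m s).
Proof.
apply/integrableP; split; first by apply/measurable_EFinP; exact: measurable_gprod.
under eq_integral => x _ do rewrite /= ger0_norm ?gprod_ge0//.
by rewrite integral_gprod ltry.
Qed.

Lemma gprod_dominated_integrable m s K (f : m.-tuple T -> R) :
  measurable_fun [set: m.-tuple T] f -> (forall x, `|f x| <= K * gprod s x) ->
  (lebesgue_tuple R m).-integrable setT (EFin \o f).
Proof.
move=> mf fK.
have iK : (lebesgue_tuple R m).-integrable setT (EFin \o (fun x => K * gprod s x)).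
  rewrite (_ : _ \o _ = (fun x => K%:E * (EFin \o gprod s) x)%E) //.
  by apply: integrableZl => //; exact: integrable_gprod.
apply: le_integrable iK => //; first by apply/measurable_EFinP.
by move=> x _ /=; rewrite lee_fin (le_trans (fK x))// ler_norm.
Qed.

End tuple_integration.

(** * Integration by parts in one real coordinate *)

Section integration_by_parts_real.
Context {R : realType}.
Local Notation mu := (@lebesgue_measure R).

Lemma normal_pdf0E (s x : R) : s != 0 ->
  normal_pdf 0 s x = normal_peak s * expR (- (x ^+ 2 / (s ^+ 2 *+ 2))).
Proof.
by move=> s0; rewrite normal_pdfE// /normal_fun subr0 mulNr.
Qed.

(** With y = x^2 / (2 s^2), exp y >= 1 + y >= y, and x^2 >= |x| once |x| >= 1. This crude decay is
    enough to kill boundary terms. *)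
Lemma normal_pdf0_le_harmonic (s x : R) : s != 0 -> 1 <= `|x| ->
  normal_pdf 0 s x <= normal_peak s * (s ^+ 2 *+ 2) / `|x|.
Proof.
move=> s0 x1; rewrite normal_pdf0E// -mulrA ler_wpM2l ?normal_peak_ge0//.
have s20 : 0 < s ^+ 2 *+ 2 by rewrite pmulrn_lgt0// exprn_even_gt0.
have x0 : 0 < `|x| by rewrite (lt_le_trans _ x1).
rewrite expRN -[leRHS]invrK lef_pV2 ?posrE ?expR_gt0//; last first.
  by rewrite invr_gt0 divr_gt0.
rewrite invf_div (le_trans _ (expR_ge1Dx _))//.
apply: (@le_trans _ _ (x ^+ 2 / (s ^+ 2 *+ 2))); last by rewrite lerDr.
by rewrite ler_pM2r ?invr_gt0// -real_normK ?num_real// expr2 ler_peMl.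
Qed.

(** Only |u n| is prescribed, so that the same statement serves both endpoints of a symmetric
    interval. *)
Lemma cvg_normal_dominated0 (s K : R) (F : R -> R) (u : nat -> R) : s != 0 ->
  (forall n, `|u n| = n.+1%:R) ->
  (forall x, `|F x| <= K * normal_pdf 0 s x) -> F (u n) @[n --> \oo] --> 0.
Proof.
move=> s0 uE FK; apply/norm_cvg0P.
pose A := `|K| * (normal_peak s * (s ^+ 2 *+ 2)).
apply: (@squeeze_cvgr _ _ _ _ (cst 0) (fun n => A * n.+1%:R^-1)) => /=.
- apply: nearW => n; rewrite normr_ge0/= (le_trans (FK _))//.
  rewrite (@le_trans _ _ (`|K| * normal_pdf 0 s (u n)))//.
    by rewrite ler_wpM2r ?normal_pdf_ge0// ler_norm.
  rewrite -mulrA ler_wpM2l// -(uE n) normal_pdf0_le_harmonic//.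
  by rewrite uE ler1n.
- exact: cvg_cst.
- rewrite -[X in _ --> X](mulr0 A); apply: cvgMr.
  exact: cvg_harmonic.
Qed.

(** On a bounded symmetric interval the integral of [G] is a difference of values of [F], which
    tends to 0 by the bound on [F]; the bound on [G] lets dominated convergence pass to the whole
    line. *)
Lemma integral_derive_eq0 (s K : R) (F G : R -> R) : s != 0 ->
  (forall x : R, is_derive x 1 F (G x)) -> continuous G ->
  (forall x, `|F x| <= K * normal_pdf 0 s x) ->
  (forall x, `|G x| <= K * normal_pdf 0 s x) ->
  (\int[mu]_x (G x)%:E = 0)%E.
Proof.
move=> s0 dF cG FK GK.
have cF : continuous F.
  move=> x; apply: differentiable_continuous; apply/derivable1_diffP.
  by have [] := dF x.
have mG : measurable_fun setT G by apply: continuous_measurable_fun.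
(* The bound [n.+1] keeps the interval nondegenerate at [n = 0], as the fundamental theorem of
   calculus requires. *)
pose E n : set R := `[- n.+1%:R, n.+1%:R]%classic.
pose f_ n := (EFin \o G) \_ (E n).
have mf_ n : measurable_fun setT (f_ n).
  apply/(measurable_restrictT _ _).1 => //; first exact: measurable_itv.
  by apply/measurable_EFinP; apply: measurable_funTS.
have f_f : {ae mu, forall x, setT x -> f_ ^~ x @ \oo --> (EFin \o G) x}.
  apply: aeW => x _; apply: cvg_near_cst.
  near=> n; rewrite /f_ patchE ifT// inE /E /= in_itv/= -ler_norml.
  apply: (@le_trans _ _ n%:R); last by rewrite ler_nat.
  by near: n; exact: nbhs_infty_ger.
have ig : mu.-integrable setT (fun x => (K * normal_pdf 0 s x)%:E).
  rewrite (_ : (fun x => _) = (fun x => K%:E * (normal_pdf 0 s x)%:E)%E) //.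
  by apply: integrableZl => //; exact: integrable_normal_pdf.
have f_g : {ae mu, forall x n, setT x -> (`|f_ n x| <= (K * normal_pdf 0 s x)%:E)%E}.
  apply: aeW => x n _; rewrite /f_ patchE; case: ifPn => _.
    by rewrite lee_fin.
  by rewrite abse0 lee_fin (le_trans _ (GK x)).
have mG' : measurable_fun setT (EFin \o G) by apply/measurable_EFinP.
have [_ _ cvgG] := @dominated_convergence _ (measurableTypeR R) R mu setT measurableT
  f_ (EFin \o G) _ mf_ mG' f_f ig f_g.
have cvg0 : (\int[mu]_x f_ n x)%E @[n --> \oo] --> 0%E.
  rewrite (_ : (fun n => _) = (fun n => (F n.+1%:R - F (- n.+1%:R))%:E)); last first.
    apply/funext => n; rewrite /f_ -integral_mkcond.
    rewrite (@continuous_FTC2 _ G F)//.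
    - by rewrite gtrN.
    - exact: continuous_subspaceT.
    - split=> [x _||]; first by have [] := dF x.
      + by apply: cvg_at_right_filter; exact: cF.
      + by apply: cvg_at_left_filter; exact: cF.
    - by move=> x _; rewrite derive1E; apply: derive_val.
  apply: cvg_EFin; first exact: nearW.
  rewrite -[X in _ --> X](subr0 0); apply: cvgB.
  - by apply: cvg_normal_dominated0 FK => // n; rewrite normr_nat.
  - by apply: (@cvg_normal_dominated0 s K F (fun n => - n.+1%:R)) => // n; rewrite normrN normr_nat.
exact: (cvg_unique _ cvgG cvg0).
Unshelve. all: by end_near. Qed.

End integration_by_parts_real.

Section integration_by_parts_tuple.
Context {R : realType}.
Local Notation T := (measurableTypeR R).
Local Notation mu := (@lebesgue_measure R).

Definition tuple_upd m (x : m.-tuple R) (i : 'I_m) (y : R) : m.-tuple R :=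
  [tuple if j == i then y else tnth x j | j < m].

Lemma tnth_tuple_upd m (x : m.-tuple R) (i j : 'I_m) (y : R) :
  tnth (tuple_upd x i y) j = if j == i then y else tnth x j.
Proof. by rewrite tnth_mktuple. Qed.

Lemma tnth_cons_lift m (y : R) (t : m.-tuple R) (k : 'I_m) :
  tnth (tuple_cons (y, t)) (lift ord0 k) = tnth t k.
Proof. by rewrite !(tnth_nth 0). Qed.

Lemma tuple_upd_cons0 m (y z : R) (t : m.-tuple R) :
  tuple_upd (tuple_cons (y, t)) ord0 z = tuple_cons (z, t).
Proof.
apply: (@eq_from_tnth _ R) => j; rewrite tnth_tuple_upd.
case: (unliftP ord0 j) => [k ->|->]; last by rewrite eqxx.
by rewrite /= !(tnth_nth 0).
Qed.

Lemma tuple_upd_consS m (y z : R) (t : m.-tuple R) (i : 'I_m) :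
  tuple_upd (tuple_cons (y, t)) (lift ord0 i) z = tuple_cons (y, tuple_upd t i z).
Proof.
apply: (@eq_from_tnth _ R) => j; rewrite tnth_tuple_upd.
case: (unliftP ord0 j) => [k ->|->]; last by rewrite (tnth_nth 0).
by rewrite (inj_eq lift_inj) !tnth_cons_lift tnth_tuple_upd.
Qed.

Lemma integral_tuple_derive_eq0 m (s K : R) (i : 'I_m) (F G : m.-tuple T -> R) : s != 0 ->
  measurable_fun [set: m.-tuple T] G ->
  (forall x (y : R), is_derive y 1 (fun z => F (tuple_upd x i z)) (G (tuple_upd x i y))) ->
  (forall x, continuous (fun z : R => G (tuple_upd x i z))) ->
  (forall x, `|F x| <= K * gprod s x) ->
  (forall x, `|G x| <= K * gprod s x) ->
  (\int[lebesgue_tuple R m]_x (G x)%:E = 0)%E.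
Proof.
move=> s0; elim: m i F G K => [[]//|m IH] i F G K mG dF cG FK GK.
have iG : (lebesgue_tuple R m.+1).-integrable setT (EFin \o G).
  exact: gprod_dominated_integrable GK.
have [iGc ->] := integral_lebesgue_tupleS iG.
case: (unliftP ord0 i) => [k ik|i0].
  rewrite -(integral12_prod_meas1 iGc) /fubini_F /=.
  apply: integral0_eq => x _.
  apply: (IH k (fun t => F (tuple_cons (x, t))) (fun t => G (tuple_cons (x, t)))
     (K * normal_pdf 0 s x)).
  - apply: measurableT_comp => //.
    by apply: measurableT_comp => //; exact: measurable_tuple_cons.
  - by move=> t y; have := dF (tuple_cons (x, t)) y; rewrite ik tuple_upd_consS;
       under eq_fun do rewrite tuple_upd_consS.
  - by move=> t; have := cG (tuple_cons (x, t)); rewrite ik;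
       under eq_fun do rewrite tuple_upd_consS.
  - by move=> t; rewrite -mulrA -(gprod_cons s (x, t)).
  - by move=> t; rewrite -mulrA -(gprod_cons s (x, t)).
rewrite -(integral21_prod_meas1 iGc) /fubini_G /=.
apply: integral0_eq => t _.
apply: (@integral_derive_eq0 R s (K * gprod s t) (fun x => F (tuple_cons (x, t)))
  (fun x => G (tuple_cons (x, t)))) => //.
- move=> y; have := dF (tuple_cons (y, t)) y; rewrite i0 tuple_upd_cons0.
  by under eq_fun do rewrite tuple_upd_cons0.
- have := cG (tuple_cons (0, t)); rewrite i0.
  by under eq_fun do rewrite tuple_upd_cons0.
- by move=> x; rewrite mulrAC -mulrA -(gprod_cons s (x, t)).
- by move=> x; rewrite mulrAC -mulrA -(gprod_cons s (x, t)).
Qed.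

End integration_by_parts_tuple.

(** * Complex calculus *)

(** Polynomials as the ring generated by constants and variables: the form in which
    differentiability, measurability, growth bounds and clearing of denominators all propagate. *)
Lemma mpoly_ring_ind (n : nat) (K : comNzRingType) (P : mpoly.mpoly n K -> Prop) :
  (forall c, P (mpoly.mpolyC n c)) -> (forall i, P (var i)) ->
  (forall p q, P p -> P q -> P (p + q)) -> (forall p q, P p -> P q -> P (p * q)) ->
  forall p, P p.
Proof.
move=> Pc Px Pa Pm p; rewrite (mpoly.mpolyE p).
have P0 : P 0 by have := Pc 0; rewrite mpoly.mpolyC0.
have P1 : P 1 by exact: Pc.
apply: (big_ind P P0 Pa) => m _; rewrite -mpoly.mul_mpolyC mpoly.mpolyXE_id.
apply: (Pm _ _ (Pc _)); apply: (big_ind P P1 Pm) => i _.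
by set k := (X in _ ^+ X); elim: k => [|k IH]; rewrite ?expr0 // exprS; apply: (Pm _ _ (Px i) IH).
Qed.

Lemma mderiv_var (n : nat) (K : comNzRingType) (i j : 'I_n) :
  mpoly.mderiv i (var j) = (i == j)%:R :> mpoly.mpoly n K.
Proof.
rewrite mpoly.mderivX mpoly.mnm1E eq_sym.
case: eqP => [->|_]; last by rewrite scale0r.
rewrite scale1r (_ : mpoly.mnm_sub _ _ = mpoly.mnm0) ?mpoly.mpolyX0//.
by apply/mpoly.mnmP => k; rewrite mpoly.mnmBE mpoly.mnm0E subnn.
Qed.

Section complex_calculus.
Context {R : realType}.
Local Notation C := R[i].
Implicit Types (f g : R -> C) (x : R) (a b c d z : C).

Lemma Re_add a b : Re (a + b) = Re a + Re b. Proof. by case: a; case: b. Qed.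
Lemma Im_add a b : Im (a + b) = Im a + Im b. Proof. by case: a; case: b. Qed.
Lemma Re_opp a : Re (- a) = - Re a. Proof. by case: a. Qed.
Lemma Im_opp a : Im (- a) = - Im a. Proof. by case: a. Qed.
Lemma Re_mul a b : Re (a * b) = Re a * Re b - Im a * Im b.
Proof. by case: a; case: b. Qed.
Lemma Im_mul a b : Im (a * b) = Re a * Im b + Im a * Re b.
Proof. by case: a; case: b. Qed.
Lemma complex_ext a b : Re a = Re b -> Im a = Im b -> a = b.
Proof. by case: a => ? ?; case: b => ? ? /= -> ->. Qed.

Lemma normc_ge_absRe z : `|Re z| <= normc z.
Proof. by case: z => p q /=; rewrite -sqrtr_sqr ler_wsqrtr// lerDl sqr_ge0. Qed.
Lemma normc_ge_absIm z : `|Im z| <= normc z.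
Proof. by case: z => p q /=; rewrite -sqrtr_sqr ler_wsqrtr// lerDr sqr_ge0. Qed.
Lemma normc_ge0 z : 0 <= normc z.
Proof. by case: z => p q /=; exact: sqrtr_ge0. Qed.
Lemma normc_real (y : R) : normc y%:C = `|y|.
Proof. by rewrite /= expr0n addr0 sqrtr_sqr. Qed.
Lemma normc_cexp z : normc (cexp z) = expR (Re z).
Proof.
rewrite /cexp Normc.normcM normc_real ger0_norm ?expR_ge0//=.
by rewrite cos2Dsin2 sqrtr1 mulr1.
Qed.
(** Taken componentwise, so that the mean value theorem and differentiation under the integral sign
    for real functions apply to each component. *)
Definition is_cderive x f d :=
  is_derive x 1 (fun y => Re (f y)) (Re d) /\ is_derive x 1 (fun y => Im (f y)) (Im d).

Lemma is_cderive_cst x c : is_cderive x (fun=> c) 0.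
Proof. by split; exact: is_derive_cst. Qed.

Lemma is_cderiveD x f g c d : is_cderive x f c -> is_cderive x g d ->
  is_cderive x (fun y => f y + g y) (c + d).
Proof.
move=> [f1 f2] [g1 g2]; split.
  by under eq_fun do rewrite Re_add; rewrite Re_add; exact: is_deriveD.
by under eq_fun do rewrite Im_add; rewrite Im_add; exact: is_deriveD.
Qed.

Lemma is_cderiveN x f c : is_cderive x f c -> is_cderive x (fun y => - f y) (- c).
Proof.
move=> [f1 f2]; split.
  by under eq_fun do rewrite Re_opp; rewrite Re_opp; exact: is_deriveN.
by under eq_fun do rewrite Im_opp; rewrite Im_opp; exact: is_deriveN.
Qed.

Lemma is_deriveM_real (u v : R -> R) x (du dv : R) : is_derive x 1 u du ->
  is_derive x 1 v dv -> is_derive x 1 (fun y => u y * v y) (u x * dv + v x * du).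
Proof. by move=> hu hv; have := is_deriveM hu hv; rewrite /GRing.scale /=. Qed.

Lemma is_cderiveM x f g c d : is_cderive x f c -> is_cderive x g d ->
  is_cderive x (fun y => f y * g y) (c * g x + f x * d).
Proof.
move=> [f1 f2] [g1 g2]; split.
  under eq_fun do rewrite Re_mul.
  apply: (is_derive_eq (is_deriveB (is_deriveM_real f1 g1) (is_deriveM_real f2 g2))).
  by rewrite Re_add !Re_mul; ring.
under eq_fun do rewrite Im_mul.
apply: (is_derive_eq (is_deriveD (is_deriveM_real f1 g2) (is_deriveM_real f2 g1))).
by rewrite Im_add !Im_mul; ring.
Qed.

Lemma is_cderive_real x (u : R -> R) (du : R) : is_derive x 1 u du ->
  is_cderive x (fun y => (u y)%:C) du%:C.
Proof. by move=> hu; split => //=; exact: is_derive_cst. Qed.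

Lemma is_cderive_eq x f c d : is_cderive x f c -> c = d -> is_cderive x f d.
Proof. by move=> ? <-. Qed.

Lemma is_cderive_sum (I : Type) (r : seq I) x (f : I -> R -> C) (d : I -> C) :
  (forall i, is_cderive x (f i) (d i)) ->
  is_cderive x (fun y => \sum_(i <- r) f i y) (\sum_(i <- r) d i).
Proof.
move=> h; elim: r => [|i r IH].
  under eq_fun do rewrite big_nil.
  by rewrite big_nil; exact: is_cderive_cst.
under eq_fun do rewrite big_cons.
by rewrite big_cons; exact: is_cderiveD.
Qed.

Lemma is_cderive_cexp x f d : is_cderive x f d ->
  is_cderive x (fun y => cexp (f y)) (d * cexp (f x)).
Proof.
move=> [f1 f2]; rewrite /cexp.
have h1 : is_cderive x (fun y => (expR (Re (f y)))%:C) (expR (Re (f x)) * Re d)%:C.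
  by apply: is_cderive_real; exact: is_derive1_comp.
have h2 : is_cderive x (fun y => cos (Im (f y)) +i* sin (Im (f y)))
   ((- sin (Im (f x)) * Im d) +i* (cos (Im (f x)) * Im d)).
  split => /=; exact: is_derive1_comp.
apply: (is_cderive_eq (is_cderiveM h1 h2)).
by apply: complex_ext; rewrite ?(Re_add, Im_add) !(Re_mul, Im_mul) /=; ring.
Qed.

Lemma is_cderive_meval M x (w : R -> 'I_M -> C) (dw : 'I_M -> C) (P : mpoly.mpoly M C) :
  (forall i, is_cderive x (fun y => w y i) (dw i)) ->
  is_cderive x (fun y => mpoly.meval (w y) P)
    (\sum_i dw i * mpoly.meval (w x) (mpoly.mderiv i P)).
Proof.
move=> h; elim/mpoly_ring_ind: P => [c|i|p q hp hq|p q hp hq].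
- under eq_fun do rewrite mpoly.mevalC.
  rewrite big1 => [|a _]; first exact: is_cderive_cst.
  by rewrite mpoly.mderivC mpoly.meval0 mulr0.
- under eq_fun do rewrite mpoly.mevalXU.
  apply: (is_cderive_eq (h i)); rewrite (bigD1 i)//= big1 ?addr0 => [|a ai].
    by rewrite mderiv_var eqxx mpoly.meval1 mulr1.
  by rewrite mderiv_var (negbTE ai) mpoly.meval0 mulr0.
- under eq_fun do rewrite mpoly.mevalD.
  apply: (is_cderive_eq (is_cderiveD hp hq)); rewrite -big_split /=.
  by apply: eq_bigr => a _; rewrite mpoly.mderivD mpoly.mevalD mulrDr.
- under eq_fun do rewrite mpoly.mevalM.
  apply: (is_cderive_eq (is_cderiveM hp hq)).
  rewrite mulr_suml mulr_sumr -big_split /=; apply: eq_bigr => a _.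
  by rewrite mpoly.mderivM mpoly.mevalD !mpoly.mevalM; ring.
Qed.

Lemma is_cderive_continuous f (df : R -> C) : (forall x, is_cderive x f (df x)) ->
  continuous (fun y => Re (f y)) /\ continuous (fun y => Im (f y)).
Proof.
move=> h; split => x; apply: differentiable_continuous; apply/derivable1_diffP.
  by have [[]] := h x.
by have [_ []] := h x.
Qed.

Definition cmeasurable disp (X : measurableType disp) (F : X -> C) :=
  measurable_fun setT (fun t => Re (F t)) /\ measurable_fun setT (fun t => Im (F t)).

Section cmeasurable.
Context disp (X : measurableType disp).
Implicit Types F G : X -> C.

Lemma cmeasurable_cst c : cmeasurable (fun _ : X => c).
Proof. by split; exact: measurable_cst. Qed.

Lemma cmeasurableD F G : cmeasurable F -> cmeasurable G ->
  cmeasurable (fun t => F t + G t).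
Proof.
move=> [f1 f2] [g1 g2]; split.
  by under eq_fun do rewrite Re_add; exact: measurable_funD.
by under eq_fun do rewrite Im_add; exact: measurable_funD.
Qed.

Lemma cmeasurableN F : cmeasurable F -> cmeasurable (fun t => - F t).
Proof.
move=> [f1 f2]; split.
  by under eq_fun do rewrite Re_opp; exact: measurable_funN.
by under eq_fun do rewrite Im_opp; exact: measurable_funN.
Qed.

Lemma cmeasurableM F G : cmeasurable F -> cmeasurable G ->
  cmeasurable (fun t => F t * G t).
Proof.
move=> [f1 f2] [g1 g2]; split.
  by under eq_fun do rewrite Re_mul; apply: measurable_funB; exact: measurable_funM.
by under eq_fun do rewrite Im_mul; apply: measurable_funD; exact: measurable_funM.
Qed.

Lemma cmeasurable_cexp F : cmeasurable F -> cmeasurable (fun t => cexp (F t)).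
Proof.
move=> [f1 f2]; apply: cmeasurableM; split => /=.
- by apply: measurableT_comp => //; exact: measurable_expR.
- exact: measurable_cst.
- apply: measurableT_comp => //; apply: continuous_measurable_fun.
  exact: continuous_cos.
- apply: measurableT_comp => //; apply: continuous_measurable_fun.
  exact: continuous_sin.
Qed.

Lemma cmeasurable_meval M (w : X -> 'I_M -> C) P :
  (forall i, cmeasurable (fun t => w t i)) ->
  cmeasurable (fun t => mpoly.meval (w t) P).
Proof.
move=> h; elim/mpoly_ring_ind: P => [c|i|p q hp hq|p q hp hq].
- by under eq_fun do rewrite mpoly.mevalC; exact: cmeasurable_cst.
- by under eq_fun do rewrite mpoly.mevalXU.
- by under eq_fun do rewrite mpoly.mevalD; exact: cmeasurableD.
- by under eq_fun do rewrite mpoly.mevalM; exact: cmeasurableM.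
Qed.
End cmeasurable.

End complex_calculus.

(** * Gaussian functionals *)

Section gaussian_functional.
Context {R : realType} (m M : nat).
Local Notation C := R[i].
Local Notation T := (measurableTypeR R).
Variable L : 'I_M -> 'I_m -> C.
Local Notation poly := (mpoly.mpoly M C).
Implicit Types (x : m.-tuple T) (P q : poly) (c e s : R).

(** The polynomial variables are complex linear forms in the real coordinates, with coefficient
    matrix [L]; a complex variable and its conjugate thus stay formally independent. *)
Definition linear_vars x (a : 'I_M) : C := \sum_k L a k * (tnth x k)%:C.
Definition ev x P : C := mpoly.meval (linear_vars x) P.
Definition norm2 x : R := \sum_k tnth x k ^+ 2.

Lemma ev_subM x (P1 P2 P3 : poly) : ev x (P1 - P2 * P3) = ev x P1 - ev x P2 * ev x P3.
Proof. by rewrite /ev mpoly.mevalB mpoly.mevalM. Qed.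

Lemma norm2_ge0 x : 0 <= norm2 x.
Proof. by apply: sumr_ge0 => k _; exact: sqr_ge0. Qed.

(** Combine |y| <= 1 + y^2 <= 1 + |x|^2 with 1 + e |x|^2 <= exp (e |x|^2); the factor 1 + 1/e
    compensates for a small [e]. *)
Lemma tnth_le_exp e x k : 0 < e -> `|tnth x k| <= (1 + e^-1) * expR (e * norm2 x).
Proof.
move=> e0; set y := tnth x k.
have yn : y ^+ 2 <= norm2 x.
  by rewrite /norm2 (bigD1 k)//= lerDl sumr_ge0// => i _; exact: sqr_ge0.
have h1 : `|y| <= 1 + y ^+ 2.
  rewrite -real_normK ?num_real//; have := sqr_ge0 (`|y| - 1); have := normr_ge0 y.
  by nra.
have h2 := expR_ge1Dx (e * norm2 x).
have h3 : 1 + y ^+ 2 <= (1 + e^-1) * (1 + e * norm2 x).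
  have eV : e^-1 * e = 1 by rewrite mulVf ?gt_eqF.
  have -> : (1 + e^-1) * (1 + e * norm2 x) = 1 + e^-1 + e * norm2 x + (e^-1 * e) * norm2 x by ring.
  rewrite eV mul1r; have : 0 < e^-1 by rewrite invr_gt0.
  have : 0 <= e * norm2 x by rewrite mulr_ge0 ?norm2_ge0// ltW.
  by lra.
apply: (le_trans h1); apply: (le_trans h3); rewrite ler_wpM2l//.
by rewrite addr_ge0// invr_ge0 ltW.
Qed.

Lemma normc_sum_le (I : Type) (r : seq I) (f : I -> C) :
  normc (\sum_(i <- r) f i) <= \sum_(i <- r) normc (f i).
Proof.
elim: r => [|i r IH]; first by rewrite !big_nil Normc.normc0.
by rewrite !big_cons (le_trans (le_normcD _ _))// lerD2l.
Qed.

(** A polynomial grows more slowly than any Gaussian exponential. The rate [e] is generalized in the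
    induction because a product spends half of it on each factor. *)
Lemma ev_growth P e : 0 < e ->
  exists2 K, 0 <= K & forall x, normc (ev x P) <= K * expR (e * norm2 x).
Proof.
move: e; elim/mpoly_ring_ind: P => [c|i|p q hp hq|p q hp hq] e e0.
- exists (normc c) => [|x]; first exact: normc_ge0.
  rewrite /ev mpoly.mevalC ler_peMr ?normc_ge0//.
  rewrite (le_trans _ (expR_ge1Dx _))// lerDl mulr_ge0 ?norm2_ge0//.
  exact: ltW.
- exists (\sum_k normc (L i k) * (1 + e^-1)) => [|x].
    apply: sumr_ge0 => k _; rewrite mulr_ge0 ?normc_ge0// addr_ge0// invr_ge0.
    exact: ltW.
  rewrite /ev mpoly.mevalXU (le_trans (normc_sum_le _ _))// mulr_suml.
  apply: ler_sum => k _; rewrite Normc.normcM normc_real -mulrA ler_wpM2l//.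
    exact: normc_ge0.
  exact: tnth_le_exp.
- have [K K0 hK] := hp e e0; have [K' K'0 hK'] := hq e e0.
  exists (K + K') => [|x]; first exact: addr_ge0.
  rewrite /ev mpoly.mevalD (le_trans (le_normcD _ _))// mulrDl.
  by rewrite lerD ?hK ?hK'.
- have e20 : 0 < e / 2 by rewrite divr_gt0.
  have [K K0 hK] := hp _ e20; have [K' K'0 hK'] := hq _ e20.
  exists (K * K') => [|x]; first exact: mulr_ge0.
  rewrite /ev mpoly.mevalM Normc.normcM.
  have -> : e * norm2 x = e / 2 * norm2 x + e / 2 * norm2 x.
    by rewrite -mulrDl -splitr.
  by rewrite expRD mulrACA ler_pM ?normc_ge0 ?hK ?hK'.
Qed.

(** The standard deviation s with 1 / (2 s^2) = c, so that the normal density is proportional to exp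
    (- c y^2). *)
Definition gdev c : R := Num.sqrt (2 * c)^-1.

Lemma gdev_neq0 c : 0 < c -> gdev c != 0.
Proof. by move=> c0; rewrite gt_eqF// sqrtr_gt0 invr_gt0 mulr_gt0. Qed.

Lemma gauss_gprod c : 0 < c ->
  exists2 K, 0 <= K & forall x, expR (- (c * norm2 x)) = K * gprod (gdev c) x.
Proof.
move=> c0; set s := gdev c; have s0 : s != 0 := gdev_neq0 c0.
have c20 : 0 < (2 * c)^-1 by rewrite invr_gt0 mulr_gt0.
exists ((normal_peak s)^-1 ^+ m).
  by rewrite exprn_ge0// invr_ge0 normal_peak_ge0.
move=> x; rewrite /gprod -[X in _ ^+ X]card_ord -prodr_const -big_split /=.
rewrite /norm2 mulr_sumr -sumrN expR_sum; apply: eq_bigr => k _.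
rewrite normal_pdf0E// mulKf; last by rewrite gt_eqF// normal_peak_gt0.
congr (expR (- _)); rewrite sqr_sqrtr ?ltW// -mulr_natr mulrC; congr (_ * _).
by field; rewrite gt_eqF.
Qed.

(** Half of the decay rate absorbs the growth of the polynomial; the other half is the remaining
    Gaussian, whence [gdev (c / 2)]. *)
Lemma ev_gauss_dominated P c : 0 < c ->
  exists2 K, 0 <= K & forall x,
    normc (ev x P) * expR (- (c * norm2 x)) <= K * gprod (gdev (c / 2)) x.
Proof.
move=> c0; have c20 : 0 < c / 2 by rewrite divr_gt0.
have [K K0 hK] := gauss_gprod c20.
have [K' K'0 hK'] := ev_growth P c20.
exists (K' * K) => [|x]; first exact: mulr_ge0.
rewrite -mulrA -hK.
have -> : - (c * norm2 x) = - (c / 2 * norm2 x) - (c / 2 * norm2 x).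
  by rewrite -opprD -mulrDl -splitr.
by rewrite expRD mulrA ler_wpM2r ?expR_ge0// expRN ler_pdivrMr ?expR_gt0.
Qed.

Definition weight q x : C := cexp (- ev x q).

(** The constant [c] is kept explicit because a single [c] along a whole segment of exponents is
    what later gives a majorant uniform in the parameter. *)
Definition coercive c q := 0 < c /\ forall x, c * norm2 x <= Re (ev x q).

Lemma normc_weight_le c q x : coercive c q -> normc (weight q x) <= expR (- (c * norm2 x)).
Proof. by move=> [_ h]; rewrite normc_cexp Re_opp ler_expR lerN2. Qed.

Lemma ev_weight_dominated c q P : coercive c q ->
  exists2 K, 0 <= K &
    forall x, normc (ev x P * weight q x) <= K * gprod (gdev (c / 2)) x.
Proof.
move=> hc; have [c0 _] := hc; have [K K0 hK] := ev_gauss_dominated P c0.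
exists K => // x; rewrite Normc.normcM (le_trans _ (hK x))//.
by rewrite ler_wpM2l ?normc_ge0// normc_weight_le.
Qed.

Lemma cmeasurable_ev P : cmeasurable (ev ^~ P).
Proof.
apply: (cmeasurable_meval (w := linear_vars)) => a; rewrite /linear_vars.
elim: (index_enum _) => [|k r IH].
  by under eq_fun do rewrite big_nil; exact: cmeasurable_cst.
under eq_fun do rewrite big_cons.
apply: cmeasurableD => //; apply: cmeasurableM; first exact: cmeasurable_cst.
by split => /=; [exact: measurable_tnth|exact: measurable_cst].
Qed.

Lemma cmeasurable_ev_weight P q : cmeasurable (fun x => ev x P * weight q x).
Proof.
apply: cmeasurableM; first exact: cmeasurable_ev.
by apply: cmeasurable_cexp; apply: cmeasurableN; exact: cmeasurable_ev.
Qed.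

Local Notation mu := (lebesgue_tuple R m).

Definition cint (F : m.-tuple T -> C) : C :=
  (\int[mu]_x Re (F x)) +i* (\int[mu]_x Im (F x)).

Definition cintegrable (F : m.-tuple T -> C) :=
  mu.-integrable setT (fun x => (Re (F x))%:E) /\
  mu.-integrable setT (fun x => (Im (F x))%:E).

Lemma cintegrable_ev_weight c P q : coercive c q ->
  cintegrable (fun x => ev x P * weight q x).
Proof.
move=> /(ev_weight_dominated P)[K K0 hK].
have [m1 m2] := cmeasurable_ev_weight P q.
split; apply: (gprod_dominated_integrable (s := gdev (c / 2)) (K := K)) => // x.
  by rewrite (le_trans (normc_ge_absRe _)).
by rewrite (le_trans (normc_ge_absIm _)).
Qed.

Lemma cintD (F G : m.-tuple T -> C) : cintegrable F -> cintegrable G ->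
  cint (fun x => F x + G x) = cint F + cint G.
Proof.
move=> [f1 f2] [g1 g2]; apply: complex_ext; rewrite ?(Re_add, Im_add) /=.
  by under eq_Rintegral do rewrite Re_add; rewrite RintegralD.
by under eq_Rintegral do rewrite Im_add; rewrite RintegralD.
Qed.

Lemma integrableZ_real (z : R) (f : m.-tuple T -> R) :
  mu.-integrable setT (EFin \o f) -> mu.-integrable setT (EFin \o (fun x => z * f x)).
Proof.
move=> fi; rewrite (_ : _ \o _ = (fun x => z%:E * (EFin \o f) x)%E) //.
exact: integrableZl.
Qed.

Lemma cintZ (z : C) (F : m.-tuple T -> C) : cintegrable F ->
  cint (fun x => z * F x) = z * cint F.
Proof.
move=> [f1 f2].
apply: complex_ext; rewrite ?(Re_mul, Im_mul).
  rewrite -[LHS]/(\int[mu]_x Re (z * F x)).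
  under eq_Rintegral do rewrite Re_mul.
  by rewrite RintegralB ?RintegralZl//; exact: integrableZ_real.
rewrite -[LHS]/(\int[mu]_x Im (z * F x)).
under eq_Rintegral do rewrite Im_mul.
by rewrite RintegralD ?RintegralZl//; exact: integrableZ_real.
Qed.

End gaussian_functional.

HB.lock Definition gint {R : realType} {m M : nat} (L : 'I_M -> 'I_m -> R[i])
    (q P : mpoly.mpoly M R[i]) : R[i] :=
  cint (fun x => ev L x P * weight L q x).

Section gint.
Context {R : realType} (m M : nat).
Local Notation C := R[i].
Local Notation T := (measurableTypeR R).
Variable L : 'I_M -> 'I_m -> C.
Local Notation poly := (mpoly.mpoly M C).
Local Notation mu := (lebesgue_tuple R m).
Local Notation ev := (ev L).
Local Notation weight := (weight L).
Local Notation linear_vars := (linear_vars L).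
Local Notation gint := (gint L).
Implicit Types (x : m.-tuple T).
Variables (c : R) (q : poly).
Hypothesis cq : coercive L c q.

Lemma gintD P Q : gint q (P + Q) = gint q P + gint q Q.
Proof.
rewrite gint.unlock -cintD; try exact: (cintegrable_ev_weight _ cq).
by congr cint; apply/funext => x; rewrite /ev mpoly.mevalD mulrDl.
Qed.

Lemma gintZ z P : gint q (z *: P) = z * gint q P.
Proof.
rewrite gint.unlock -cintZ; last exact: (cintegrable_ev_weight _ cq).
by congr cint; apply/funext => x; rewrite /ev mpoly.mevalZ mulrA.
Qed.

Lemma gint0 : gint q 0 = 0.
Proof. by have := gintZ 0 0; rewrite scale0r mul0r. Qed.

Lemma gintN P : gint q (- P) = - gint q P.
Proof. by rewrite -scaleN1r gintZ mulN1r. Qed.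

Lemma gintB P Q : gint q (P - Q) = gint q P - gint q Q.
Proof. by rewrite gintD gintN. Qed.

Lemma gint_sum (I : Type) (r : seq I) (F : I -> poly) :
  gint q (\sum_(i <- r) F i) = \sum_(i <- r) gint q (F i).
Proof.
elim: r => [|i r IH]; first by rewrite !big_nil gint0.
by rewrite !big_cons gintD IH.
Qed.

Lemma is_cderive_ev_upd P x k (y : R) :
  is_cderive y (fun z => ev (tuple_upd x k z) P)
    (ev (tuple_upd x k y) (\sum_a L a k *: mpoly.mderiv a P)).
Proof.
apply: is_cderive_eq.
  apply: (is_cderive_meval (w := fun z => linear_vars (tuple_upd x k z))
    (dw := fun a => L a k)) => a.
  rewrite /linear_vars.
  apply: (is_cderive_eq (c := \sum_j L a j * (if j == k then 1 else 0))).
    apply: is_cderive_sum => j.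
    under eq_fun do rewrite tnth_tuple_upd.
    apply: is_cderive_eq.
      apply: is_cderiveM; first exact: is_cderive_cst.
      instantiate (1 := if j == k then 1 else 0).
      case: eqP => _; last exact: is_cderive_cst.
      by apply: (is_cderive_real (u := id)); exact: is_derive_id.
    by rewrite mul0r add0r.
  rewrite (bigD1 k)//= eqxx mulr1 big1 ?addr0// => j /negbTE ->.
  by rewrite mulr0.
rewrite /ev raddf_sum /=; apply: eq_bigr => a _.
by rewrite mpoly.mevalZ.
Qed.

Lemma is_cderive_ev_weight P x k (y : R) :
  is_cderive y (fun z => ev (tuple_upd x k z) P * weight q (tuple_upd x k z))
    (let x' := tuple_upd x k y in
     ev x' (\sum_a L a k *: (mpoly.mderiv a P - P * mpoly.mderiv a q)) * weight q x').
Proof.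
apply: is_cderive_eq.
  apply: is_cderiveM; first exact: is_cderive_ev_upd.
  by apply: is_cderive_cexp; apply: is_cderiveN; exact: is_cderive_ev_upd.
rewrite /= /weight; set x' := tuple_upd x k y.
have -> : \sum_a L a k *: (mpoly.mderiv a P - P * mpoly.mderiv a q) =
   (\sum_a L a k *: mpoly.mderiv a P) - P * (\sum_a L a k *: mpoly.mderiv a q).
  rewrite mulr_sumr -sumrB; apply: eq_bigr => a _.
  by rewrite scalerBr -scalerAr.
set dP := \sum_a L a k *: mpoly.mderiv a P; set dq := \sum_a L a k *: mpoly.mderiv a q.
rewrite ev_subM.
move: (ev x' dP) (ev x' P) (ev x' dq) (cexp _) => u v w z; ring.
Qed.

(** The argument, times the weight, is the partial derivative of [P] times the weight in the real
    coordinate [k], hence integrates to 0. *)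
Lemma gint_by_parts k P :
  gint q (\sum_a L a k *: (mpoly.mderiv a P - P * mpoly.mderiv a q)) = 0.
Proof.
set Q := \sum_a _.
have [K1 K10 h1] := ev_weight_dominated P cq.
have [K2 K20 h2] := ev_weight_dominated Q cq.
have [c0 _] := cq; have c20 : 0 < c / 2 by rewrite divr_gt0.
have s0 := gdev_neq0 c20.
have [mQ1 mQ2] := cmeasurable_ev_weight L Q q.
(* One constant has to bound both the function and its derivative, so the two bounds are added. *)
have hP x : normc (ev x P * weight q x) <= (K1 + K2) * gprod (gdev (c / 2)) x.
  by rewrite mulrDl (le_trans (h1 x))// lerDl mulr_ge0 ?gprod_ge0.
have hQ x : normc (ev x Q * weight q x) <= (K1 + K2) * gprod (gdev (c / 2)) x.
  by rewrite mulrDl (le_trans (h2 x))// lerDr mulr_ge0 ?gprod_ge0.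
rewrite gint.unlock; apply: complex_ext.
  change (fine (integral mu setT (fun x => (Re (ev x Q * weight q x))%:E)) = fine 0%E); congr fine.
  apply: (@integral_tuple_derive_eq0 R m _ (K1 + K2) k
    (fun x => Re (ev x P * weight q x)) (fun x => Re (ev x Q * weight q x)) s0) => //.
  - by move=> x y; have [] := is_cderive_ev_weight P x k y.
  - move=> x; have [] := is_cderive_continuous (is_cderive_ev_weight Q x k).
    by [].
  - by move=> x; rewrite (le_trans (normc_ge_absRe _)).
  - by move=> x; rewrite (le_trans (normc_ge_absRe _)).
change (fine (integral mu setT (fun x => (Im (ev x Q * weight q x))%:E)) = fine 0%E); congr fine.
apply: (@integral_tuple_derive_eq0 R m _ (K1 + K2) k
    (fun x => Im (ev x P * weight q x)) (fun x => Im (ev x Q * weight q x)) s0) => //.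
- by move=> x y; have [] := is_cderive_ev_weight P x k y.
- move=> x; have [] := is_cderive_continuous (is_cderive_ev_weight Q x k).
  by [].
- by move=> x; rewrite (le_trans (normc_ge_absIm _)).
- by move=> x; rewrite (le_trans (normc_ge_absIm _)).
Qed.

(** Combining the real partial derivatives with the coefficients in column [a] of [Linv] isolates
    the derivative in the single complex variable [a]. *)
Lemma schwinger_dyson (Linv : 'I_m -> 'I_M -> C) a P :
  (forall b, \sum_k Linv k a * L b k = (b == a)%:R) ->
  gint q (P * mpoly.mderiv a q) = gint q (mpoly.mderiv a P).
Proof.
move=> LK; apply/eqP; rewrite eq_sym -subr_eq0 -gintB; apply/eqP.
have -> : mpoly.mderiv a P - P * mpoly.mderiv a q =
  \sum_k Linv k a *: \sum_b L b k *: (mpoly.mderiv b P - P * mpoly.mderiv b q).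
  under eq_bigr do rewrite scaler_sumr; rewrite exchange_big /=.
  under eq_bigr => b _ do under eq_bigr do rewrite scalerA.
  under eq_bigr => b _ do rewrite -scaler_suml LK.
  rewrite (bigD1 a)//= eqxx scale1r big1 ?addr0// => b /negbTE ->.
  by rewrite scale0r.
rewrite gint_sum big1// => k _.
by rewrite gintZ gint_by_parts mulr0.
Qed.
End gint.

(** * Dependence of Gaussian integrals on a real parameter *)

Section parameter_derivative.
Context {R : realType} (m M : nat).
Local Notation C := R[i].
Local Notation T := (measurableTypeR R).
Variable L : 'I_M -> 'I_m -> C.
Local Notation poly := (mpoly.mpoly M C).
Local Notation mu := (lebesgue_tuple R m).
Variables (c u v : R) (q h P : poly).

Let qs (s : R) : poly := q + s%:C *: h.

Hypothesis cqs : forall s, s \in `]u, v[ -> coercive L c (qs s).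

Let is_cderive_weight (x : m.-tuple T) (s : R) :
  is_cderive s (fun t => ev L x P * weight L (qs t) x)
    (ev L x (- (P * h)) * weight L (qs s) x).
Proof.
apply: is_cderive_eq.
  apply: is_cderiveM; first exact: is_cderive_cst.
  apply: is_cderive_cexp; apply: is_cderiveN.
  rewrite /ev /qs.
  under eq_fun do rewrite mpoly.mevalD mpoly.mevalZ.
  apply: is_cderiveD; first exact: is_cderive_cst.
  apply: is_cderiveM; last exact: is_cderive_cst.
  by apply: (is_cderive_real (u := id)); exact: is_derive_id.
by rewrite /weight /ev !(mpoly.mevalN, mpoly.mevalM); ring.
Qed.

(** The majorant [K * gprod s x] does not depend on [t]; this uniformity is what differentiation
    under the integral sign needs. *)
Lemma is_derive_under_integral (f f' : R -> m.-tuple T -> R) (K s : R) a :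
  a \in `]u, v[ ->
  (forall t, t \in `]u, v[ -> mu.-integrable setT (EFin \o f t)) ->
  (forall x (t : R), is_derive t 1 (f ^~ x) (f' t x)) ->
  0 <= K -> (forall x t, t \in `]u, v[ -> `|f' t x| <= K * gprod s x) ->
  is_derive (a : R) 1 (fun t => \int[mu]_x f t x) (\int[mu]_x f' a x).
Proof.
move=> auv fi df K0 f'K.
have d1 t x : partial1of2 f t x = f' t x.
  by rewrite partial1of2E; apply: derive_val.
have gi : mu.-integrable setT (EFin \o (fun x => K * gprod s x)).
  by apply: (integrableZ_real K (f := gprod s)); exact: integrable_gprod.
have g0 (x : m.-tuple T) : 0 <= K * gprod s x by rewrite mulr_ge0 ?gprod_ge0.
have Ia : [set` `]u, v[] a by [].
have bd t x : [set` `]u, v[] t -> setT x -> `|partial1of2 f t x| <= K * gprod s x.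
  by move=> /= tuv _; rewrite d1 f'K.
have dd t x : [set` `]u, v[] t -> setT x -> derivable (f ^~ x) t 1.
  by move=> _ _; have [] := df x t.
apply: DeriveDef.
  exact: (derivable_under_integral measurableT Ia fi dd g0 gi bd).
rewrite -derive1E (differentiation_under_integral measurableT Ia fi dd g0 gi bd).
by apply: eq_Rintegral => x _; rewrite d1.
Qed.

(** Differentiating exp (- q - s h) in [s] brings down the factor - h. Coercivity with one [c] for
    all parameters in the open interval supplies the uniform majorant. *)
Lemma gint_cderive a : a \in `]u, v[ ->
  is_cderive a (fun s => gint L (qs s) P) (- gint L (qs a) (P * h)).
Proof.
move=> auv; rewrite -(gintN (cqs auv)).
rewrite gint.unlock; have [c0 _] := cqs auv.
have [K K0 hK] := ev_gauss_dominated L (- (P * h)) c0.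
have bound x t : t \in `]u, v[ ->
    normc (ev L x (- (P * h)) * weight L (qs t) x) <= K * gprod (gdev (c / 2)) x.
  move=> tuv; rewrite Normc.normcM (le_trans _ (hK x))//.
  by rewrite ler_wpM2l ?normc_ge0// normc_weight_le//; exact: cqs.
split.
  apply: (@is_derive_under_integral (fun t x => Re (ev L x P * weight L (qs t) x))
    (fun t x => Re (ev L x (- (P * h)) * weight L (qs t) x)) K (gdev (c / 2))) => //.
  - by move=> t tuv; have [] := cintegrable_ev_weight P (cqs tuv).
  - by move=> x t; have [] := is_cderive_weight x t.
  - by move=> x t tuv; rewrite (le_trans (normc_ge_absRe _)) ?bound.
apply: (@is_derive_under_integral (fun t x => Im (ev L x P * weight L (qs t) x))
  (fun t x => Im (ev L x (- (P * h)) * weight L (qs t) x)) K (gdev (c / 2))) => //.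
- by move=> t tuv; have [] := cintegrable_ev_weight P (cqs tuv).
- by move=> x t; have [] := is_cderive_weight x t.
- by move=> x t tuv; rewrite (le_trans (normc_ge_absIm _)) ?bound.
Qed.

End parameter_derivative.

Lemma is_derive_segment_cst {R : realType} (f : R -> R) (x y : R) : x <= y ->
  (forall t, t \in `[x, y] -> is_derive t 1 f 0) -> f x = f y.
Proof.
move=> xy df; apply/esym/eqP; rewrite -subr_eq0; apply/eqP.
have d0 t : t \in `]x, y[ -> is_derive t 1 f 0 by move/subset_itv_oo_cc; exact: df.
have cf : {within `[x, y], continuous f}.
  by apply: derivable_within_continuous => t txy; have [] := df t txy.
by have [z _ ->] := @MVT_segment R f (fun=> 0) x y xy d0 cf; rewrite mul0r.
Qed.

Lemma is_cderive_segment_cst {R : realType} (f : R -> R[i]) (x y : R) : x <= y ->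
  (forall t, t \in `[x, y] -> is_cderive t f 0) -> f x = f y.
Proof.
move=> xy df; apply: complex_ext.
  by apply: (is_derive_segment_cst (f := fun t => Re (f t)) xy) => t /df[].
by apply: (is_derive_segment_cst (f := fun t => Im (f t)) xy) => t /df[].
Qed.

(** * Matrix derivations *)

Section matrix_derivation.
Variables (K : comNzRingType) (n : nat) (D : K -> K).
Hypothesis D_add : {morph D : x y / x + y}.
Hypothesis D_mul : forall x y, D (x * y) = D x * y + x * D y.

Lemma derivation0 : D 0 = 0.
Proof. by apply: (addrI (D 0)); rewrite -D_add !addr0. Qed.

Lemma derivation1 : D 1 = 0.
Proof. by apply: (addrI (D 1)); rewrite addr0 -{3}(mulr1 1) D_mul mulr1 mul1r. Qed.

Lemma derivation_sum (I : Type) (r : seq I) (F : I -> K) :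
  D (\sum_(i <- r) F i) = \sum_(i <- r) D (F i).
Proof. by apply: big_morph; [exact: D_add | exact: derivation0]. Qed.

(** [uniq r] matters: the omitted factor is described by [u != t], which would remove every
    repetition of [t]. *)
Lemma derivation_prod (I : eqType) (r : seq I) (F : I -> K) : uniq r ->
  D (\prod_(u <- r) F u) = \sum_(t <- r) (\prod_(u <- r | u != t) F u) * D (F t).
Proof.
elim: r => [|a r IH]; first by rewrite !big_nil derivation1.
rewrite cons_uniq => /andP[ar ur]; rewrite !big_cons D_mul IH// eqxx /=.
rewrite mulrC; congr (_ * _ + _).
  rewrite [LHS]big_seq [RHS]big_seq_cond; apply: eq_bigl => u.
  by case: (boolP (u \in r)) => // ur'; rewrite (memPn ar _ ur').
rewrite mulr_sumr !big_seq; apply: eq_bigr => t tr.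
by rewrite big_cons eq_sym (memPn ar _ tr) mulrA.
Qed.

Implicit Types A B : 'M[K]_n.

Lemma derivation_mxM A B : map_mx D (A * B) = map_mx D A * B + A * map_mx D B.
Proof.
apply/matrixP => i j; rewrite !mxE derivation_sum -big_split /=.
by apply: eq_bigr => k _; rewrite D_mul !mxE.
Qed.

Lemma derivation_mx1 : map_mx D (1 : 'M[K]_n) = 0.
Proof.
apply/matrixP => i j; rewrite !mxE.
by case: (i == j); rewrite ?derivation0 ?derivation1.
Qed.

Lemma derivation_tr A : D (\tr A) = \tr (map_mx D A).
Proof.
by rewrite /mxtrace derivation_sum; apply: eq_bigr => i _; rewrite mxE.
Qed.

Lemma derivation_mxX A k :
  map_mx D (A ^+ k) = \sum_(0 <= j < k) A ^+ j * map_mx D A * A ^+ (k - j - 1).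
Proof.
elim: k => [|k IH]; first by rewrite expr0 derivation_mx1 big_geq.
rewrite exprSr derivation_mxM IH big_nat_recr //= subSn// subnn subn1 /= expr0 mulr1.
congr (_ + _); rewrite mulr_suml; apply: eq_big_nat => j /andP[_ jk].
by rewrite -mulrA -exprSr; congr (_ * _ ^+ _); lia.
Qed.

Lemma word_recr (k l : nat -> nat) a b A B : (a <= b)%N ->
  word k l a b.+1 A B = word k l a b A B * (A ^+ k b * B ^+ l b).
Proof. exact: big_nat_recr. Qed.

Lemma word_geq (k l : nat -> nat) a b A B : (b <= a)%N -> word k l a b A B = 1.
Proof. exact: big_geq. Qed.

Lemma derivation_word (k l : nat -> nat) a b A B : (a <= b)%N ->
  map_mx D (word k l a b A B) = \sum_(a <= r < b)
    word k l a r A B * map_mx D (A ^+ k r * B ^+ l r) * word k l r.+1 b A B.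
Proof.
move=> ab; rewrite -(subnKC ab); elim: (b - a)%N => [|d IH].
  by rewrite addn0 big_geq// word_geq// derivation_mx1.
rewrite addnS word_recr ?leq_addr// derivation_mxM IH [RHS]big_nat_recr ?leq_addr//=.
rewrite [X in _ = _ + _ * X]word_geq // mulr1; congr (_ + _).
rewrite mulr_suml; apply: eq_big_nat => r /andP[_ rd].
by rewrite word_recr// [RHS]mulrA.
Qed.

End matrix_derivation.

Section matrix_divergence.
Variables (K : comNzRingType) (n : nat) (D : 'I_n -> 'I_n -> K -> K).
Hypothesis D_add : forall i j, {morph D i j : x y / x + y}.
Hypothesis D_mul : forall i j x y, D i j (x * y) = D i j x * y + x * D i j y.

(** Replacing one letter of a word by an elementary matrix cuts the word: the entry factors into an
    entry of what stands before and an entry of what stands after. *)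
Lemma mul_delta_mxE (X Y : 'M[K]_n) i j a b :
  (X * delta_mx i j * Y) a b = X a i * Y j b.
Proof.
rewrite !mxE (bigD1 j)//= !mxE (bigD1 i)//= !mxE !eqxx mulr1.
rewrite big1 => [|u /negbTE ui]; last by rewrite !mxE ui mulr0.
rewrite big1 ?addr0// => v /negbTE vj.
rewrite !mxE big1 ?mul0r// => u _.
by rewrite !mxE vj andbF mulr0.
Qed.

(** The splitting and joining terms of the loop equations. Differentiating the entry of [f 0] yields
    X_ii Y_jj, which sums to a product of two traces. Differentiating a trace factor yields (Y X)_ji
    times the entry (i, j) of [f 0], which sums to a single trace with [f 0] inserted at the cut, by
    cyclicity. *)
Lemma divergence_word_product (p : nat) (f : nat -> 'M[K]_n)
    (len : nat -> nat) (k : nat -> nat -> nat) (X Y : nat -> nat -> nat -> 'M[K]_n) :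
  (forall t i j, map_mx (D i j) (f t) =
    \sum_(1 <= r < (len t).+1) \sum_(0 <= s < k t r) X t r s * delta_mx i j * Y t r s) ->
  \sum_i \sum_j D i j (\prod_(1 <= u < p.+1) \tr (f u) * f 0%N i j) =
  \sum_(1 <= r < (len 0%N).+1) \sum_(0 <= s < k 0%N r)
     \prod_(1 <= u < p.+1) \tr (f u) * \tr (X 0%N r s) * \tr (Y 0%N r s)
  + \sum_(1 <= t < p.+1) \sum_(1 <= r < (len t).+1) \sum_(0 <= s < k t r)
     \prod_(1 <= u < p.+1 | u != t) \tr (f u) * \tr (X t r s * f 0%N * Y t r s).
Proof.
move=> Df; set G0 := \prod_(_ <= _ < _) _.
under eq_bigr => i _ do under eq_bigr => j _ do rewrite D_mul addrC.
under eq_bigr => i _ do rewrite big_split /=.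
rewrite big_split /=; congr (_ + _).
  have E i j : G0 * D i j (f 0%N i j) = \sum_(1 <= r < (len 0%N).+1)
      \sum_(0 <= s < k 0%N r) G0 * (X 0%N r s i i * Y 0%N r s j j).
    have -> : D i j (f 0%N i j) = (map_mx (D i j) (f 0%N)) i j by rewrite mxE.
    rewrite Df summxE mulr_sumr; apply: eq_bigr => r _.
    rewrite summxE mulr_sumr; apply: eq_bigr => s _.
    by rewrite mul_delta_mxE.
  under eq_bigr => i _ do under eq_bigr => j _ do rewrite E.
  under eq_bigr => i _ do rewrite exchange_big /=.
  rewrite exchange_big /=; apply: eq_bigr => r _.
  under eq_bigr => i _ do rewrite exchange_big /=.
  rewrite exchange_big /=; apply: eq_bigr => s _.
  rewrite /mxtrace -mulrA mulr_suml mulr_sumr; apply: eq_bigr => i _.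
  by rewrite !mulr_sumr.
have E i j : D i j G0 * f 0%N i j = \sum_(1 <= t < p.+1)
    \sum_(1 <= r < (len t).+1) \sum_(0 <= s < k t r)
    \prod_(1 <= u < p.+1 | u != t) \tr (f u) * ((Y t r s * X t r s) j i * f 0%N i j).
  rewrite (derivation_prod (D_mul i j)) ?iota_uniq// mulr_suml.
  apply: eq_bigr => t _.
  rewrite (derivation_tr (D_add i j)) Df raddf_sum mulr_sumr mulr_suml.
  apply: eq_bigr => r _; rewrite raddf_sum mulr_sumr mulr_suml.
  apply: eq_bigr => s _; rewrite -mulrA; congr (_ * (_ * _)).
  by rewrite /mxtrace mxE; apply: eq_bigr => a _; rewrite mul_delta_mxE mulrC.
under eq_bigr => i _ do under eq_bigr => j _ do rewrite E.
under eq_bigr => i _ do rewrite exchange_big /=.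
rewrite exchange_big /=; apply: eq_bigr => t _.
under eq_bigr => i _ do rewrite exchange_big /=.
rewrite exchange_big /=; apply: eq_bigr => r _.
under eq_bigr => i _ do rewrite exchange_big /=.
rewrite exchange_big /=; apply: eq_bigr => s _.
under eq_bigr => i _ do rewrite -mulr_sumr.
rewrite -mulr_sumr; congr (_ * _).
rewrite -[RHS]/(\tr (X t r s *m f 0%N *m Y t r s)) mxtrace_mulC mulmxA mxtrace_mulC.
rewrite /mxtrace; apply: eq_bigr => i _; rewrite [RHS]mxE; apply: eq_bigr => j _.
by rewrite mulrC.
Qed.

End matrix_divergence.

(** * Matrix variables *)

Section matrix_indices.
Variable n : nat.

Definition iZ (i j : 'I_n) : 'I_(n * n + n * n) :=
  lshift (n * n) (mxvec_index i j).

(* With this transposed index, the variable [rshift p] is evaluated at the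
   conjugate of the variable [lshift p]. *)
Definition iW (i j : 'I_n) : 'I_(n * n + n * n) :=
  rshift (n * n) (mxvec_index j i).

End matrix_indices.

(* [Zmx] and [Wmx] are sealed because unification must never try to decide
   whether their polynomial entries are convertible. *)
HB.lock Definition Zmx (R : realType) (n : nat)
    : 'M[mpoly.mpoly (n * n + n * n) R[i]]_n :=
  \matrix_(i, j) var (iZ i j).

HB.lock Definition Wmx (R : realType) (n : nat)
    : 'M[mpoly.mpoly (n * n + n * n) R[i]]_n :=
  \matrix_(i, j) var (iW i j).

Lemma ZmxE (R : realType) n i j : Zmx R n i j = var (iZ i j).
Proof. by rewrite Zmx.unlock mxE. Qed.

Lemma WmxE (R : realType) n i j : Wmx R n i j = var (iW i j).
Proof. by rewrite Wmx.unlock mxE. Qed.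

Section matrix_variables.
Context {R : realType} (n : nat).
Local Notation C := R[i].
Local Notation T := (measurableTypeR R).
Local Notation N := (n * n + n * n)%N.
Local Notation poly := (mpoly.mpoly N C).

(** With x_p and y_p the real coordinates, the first n^2 variables are x_p + i y_p and the last n^2
    are their conjugates x_p - i y_p. *)
Definition lin (a k : 'I_N) : C :=
  match fintype.split a with
  | inl p => (k == lshift (n * n) p)%:R + 'i * (k == rshift (n * n) p)%:R
  | inr p => (k == lshift (n * n) p)%:R - 'i * (k == rshift (n * n) p)%:R
  end.

(** Coefficients of the Wirtinger operators (d/dx - i d/dy) / 2 and (d/dx + i d/dy) / 2. *)
Definition lin_inv (k a : 'I_N) : C :=
  match fintype.split a with
  | inl p => ((k == lshift (n * n) p)%:R - 'i * (k == rshift (n * n) p)%:R) / 2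
  | inr p => ((k == lshift (n * n) p)%:R + 'i * (k == rshift (n * n) p)%:R) / 2
  end.

Lemma split_lshift (p : 'I_(n * n)) : fintype.split (lshift (n * n) p) = inl p.
Proof. exact: (unsplitK (inl p)). Qed.
Lemma split_rshift (p : 'I_(n * n)) : fintype.split (rshift (n * n) p) = inr p.
Proof. exact: (unsplitK (inr p)). Qed.

Lemma sum_split (F : 'I_N -> C) (c d : C) p :
  \sum_k (c * (k == lshift (n * n) p)%:R + d * (k == rshift (n * n) p)%:R) * F k =
  c * F (lshift (n * n) p) + d * F (rshift (n * n) p).
Proof.
rewrite big_split_ord /=; congr (_ + _).
  rewrite (bigD1 p)//= eqxx eq_lrshift mulr0 addr0 mulr1 big1 ?addr0// => k /negbTE kp.
  by rewrite eq_lshift kp eq_lrshift !mulr0 addr0 mul0r.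
rewrite (bigD1 p)//= eqxx eq_rlshift mulr0 add0r mulr1 big1 ?addr0// => k /negbTE kp.
by rewrite eq_rshift kp eq_rlshift !mulr0 addr0 mul0r.
Qed.

Lemma lin_invK a b : \sum_k lin_inv k a * lin b k = (b == a)%:R.
Proof.
have i2 : 'i * 'i = -1 :> C by rewrite -expr2 sqr_i.
have h2 : (2 : C) != 0 by rewrite pnatr_eq0.
rewrite -(splitK a) -(splitK b) /lin_inv; case: (fintype.split a) => p /=;
  rewrite ?split_lshift ?split_rshift.
  have -> : \sum_k ((k == lshift (n * n) p)%:R - 'i * (k == rshift (n * n) p)%:R) / 2
      * lin (unsplit (fintype.split b)) k = 
     \sum_k (2^-1 * (k == lshift (n * n) p)%:R + (- 'i / 2) * (k == rshift (n * n) p)%:R) * lin (unsplit (fintype.split b)) k.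
    by apply: eq_bigr => k _; congr (_ * _); ring.
  rewrite sum_split /lin; case: (fintype.split b) => s /=.
    rewrite split_lshift !eq_lshift eq_sym !eq_lrshift !eq_rlshift ?eq_rshift.
    rewrite (eq_sym p s) mulr0 addr0 add0r.
    case: (s == p); rewrite ?mulr0 ?addr0// !mulr1.
    by rewrite mulrAC mulNr i2 opprK /= ?mulr1n; field.
  rewrite split_rshift !eq_lshift !eq_lrshift !eq_rlshift ?eq_rshift (eq_sym p s).
  rewrite mulr0 subr0 sub0r.
  case: (s == p); rewrite ?(mulr0, addr0, oppr0)// !mulr1.
  by rewrite mulrN mulrAC mulNr i2 opprK /= ?mulr1n; field.
have -> : \sum_k ((k == lshift (n * n) p)%:R + 'i * (k == rshift (n * n) p)%:R) / 2
    * lin (unsplit (fintype.split b)) k = 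
   \sum_k (2^-1 * (k == lshift (n * n) p)%:R + ('i / 2) * (k == rshift (n * n) p)%:R) * lin (unsplit (fintype.split b)) k.
  by apply: eq_bigr => k _; congr (_ * _); ring.
rewrite sum_split /lin; case: (fintype.split b) => s /=.
  rewrite split_lshift !eq_lshift !eq_lrshift !eq_rlshift ?eq_rshift (eq_sym p s).
  rewrite mulr0 addr0 add0r.
  case: (s == p); rewrite ?mulr0 ?addr0// !mulr1.
  by rewrite mulrAC i2 /= ?mulr1n; field.
rewrite split_rshift !eq_lshift !eq_lrshift !eq_rlshift ?eq_rshift (eq_sym p s).
rewrite mulr0 subr0 sub0r.
case: (s == p); rewrite ?(mulr0, addr0, oppr0)// !mulr1.
by rewrite mulrN mulrAC i2 /= ?mulr1n; field.
Qed.

Local Notation iZ := (@iZ n).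
Local Notation iW := (@iW n).
Local Notation Zmx := (Zmx R n).
Local Notation Wmx := (Wmx R n).

Lemma conjE (z : C) : Num.conj z = complex.Re z -i* complex.Im z.
Proof. by case: z. Qed.

Lemma linear_vars_iZ (x : N.-tuple T) i j :
  linear_vars lin x (iZ i j) = mx_of_tuple x i j.
Proof.
rewrite /linear_vars mxE /lin /iZ; under eq_bigr do rewrite split_lshift -[X in X + _]mul1r.
rewrite sum_split mul1r; apply: complex_ext; rewrite ?(Re_add, Im_add, Re_mul, Im_mul) /=; ring.
Qed.

Lemma linear_vars_iW (x : N.-tuple T) i j :
  linear_vars lin x (iW i j) = ((mx_of_tuple x) ^t*) i j.
Proof.
rewrite /linear_vars !mxE /lin /iW conjE.
under eq_bigr do rewrite split_rshift -[X in X - _]mul1r -mulNr.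
rewrite sum_split mul1r; apply: complex_ext; rewrite ?(Re_add, Im_add, Re_mul, Im_mul) /=; ring.
Qed.

Lemma mxvec_index_eq (i j k l : 'I_n) :
  (mxvec_index i j == mxvec_index k l) = (i == k) && (j == l).
Proof.
have [g gK _] := curry_mxvec_bij n n.
apply/eqP/andP => [e|[/eqP-> /eqP->]//].
by have := gK (i, j) isT; rewrite /= e (gK (k, l) isT) => -[-> ->].
Qed.

Lemma iZ_eq i j k l : (iZ i j == iZ k l) = (i == k) && (j == l).
Proof. by rewrite eq_lshift mxvec_index_eq. Qed.
Lemma iW_eq i j k l : (iW i j == iW k l) = (i == k) && (j == l).
Proof. by rewrite eq_rshift mxvec_index_eq andbC. Qed.
Lemma iZW_eq i j k l : (iZ i j == iW k l) = false.
Proof. exact: eq_lrshift. Qed.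

Lemma mderiv_Zmx i j : map_mx (mpoly.mderiv (iZ i j)) Zmx = delta_mx i j.
Proof.
apply/matrixP => k l; rewrite mxE ZmxE mxE mderiv_var iZ_eq.
by rewrite (eq_sym i) (eq_sym j).
Qed.
Lemma mderiv_W_Zmx i j : map_mx (mpoly.mderiv (iW i j)) Zmx = 0.
Proof. by apply/matrixP => k l; rewrite mxE ZmxE mxE mderiv_var eq_sym iZW_eq. Qed.
Lemma mderiv_Wmx i j : map_mx (mpoly.mderiv (iW i j)) Wmx = delta_mx i j.
Proof.
apply/matrixP => k l; rewrite mxE WmxE mxE mderiv_var iW_eq.
by rewrite (eq_sym i) (eq_sym j).
Qed.
Lemma mderiv_Z_Wmx i j : map_mx (mpoly.mderiv (iZ i j)) Wmx = 0.
Proof. by apply/matrixP => k l; rewrite mxE WmxE mxE mderiv_var iZW_eq. Qed.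

Definition gauss_form (a1 a2 g : C) : poly :=
  (a1 / 2) *: \tr (Zmx * Zmx) + (a2 / 2) *: \tr (Wmx * Wmx) + g *: \tr (Zmx * Wmx).

Lemma tr_delta_mul i j (A : 'M[poly]_n) : \tr (delta_mx i j * A) = A j i.
Proof.
rewrite /mxtrace (bigD1 i)//= big1 => [|k /negbTE ki].
  rewrite addr0 mxE (bigD1 j)//= big1 => [|l /negbTE lj].
    by rewrite mxE !eqxx mul1r addr0.
  by rewrite mxE lj andbF mul0r.
by rewrite mxE big1// => l _; rewrite mxE ki mul0r.
Qed.

Lemma mxtrace_mulC_ring (A B : 'M[poly]_n) : \tr (A * B) = \tr (B * A).
Proof. exact: mxtrace_mulC. Qed.

Lemma mderiv_comb3 v (c1 c2 c3 : C) (P1 P2 P3 D1 D2 D3 : poly) :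
  mpoly.mderiv v P1 = D1 -> mpoly.mderiv v P2 = D2 -> mpoly.mderiv v P3 = D3 ->
  mpoly.mderiv v (c1 *: P1 + c2 *: P2 + c3 *: P3) = c1 *: D1 + c2 *: D2 + c3 *: D3.
Proof.
move=> <- <- <-.
by rewrite !mpoly.mderivD; congr (_ + _ + _); exact: mpoly.mderivZ.
Qed.

Lemma mderiv_tr_mul v (A B : 'M[poly]_n) :
  mpoly.mderiv v (\tr (A * B)) =
  \tr (map_mx (mpoly.mderiv v) A * B) + \tr (map_mx (mpoly.mderiv v) B * A).
Proof.
have Da : {morph (mpoly.mderiv v : poly -> poly) : x y / x + y} by exact: mpoly.mderivD.
have Dm (x y : poly) : mpoly.mderiv v (x * y) = mpoly.mderiv v x * y + x * mpoly.mderiv v y.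
  exact: mpoly.mderivM.
rewrite (derivation_tr Da) (derivation_mxM Da Dm) [LHS]mxtraceD; congr (_ + _).
exact: mxtrace_mulC_ring.
Qed.

Lemma scale2_half (c : C) (P : poly) : (c / 2) *: (P + P) = c *: P.
Proof. by rewrite scalerDr -scalerDl; congr (_ *: _); field. Qed.

Lemma mderiv_gauss_form_Z a1 a2 g i j :
  mpoly.mderiv (iZ i j) (gauss_form a1 a2 g) = a1 *: Zmx j i + g *: Wmx j i.
Proof.
have e1 : mpoly.mderiv (iZ i j) (\tr (Zmx * Zmx)) = Zmx j i + Zmx j i.
  by rewrite mderiv_tr_mul mderiv_Zmx tr_delta_mul.
have e2 : mpoly.mderiv (iZ i j) (\tr (Wmx * Wmx)) = 0.
  by rewrite mderiv_tr_mul mderiv_Z_Wmx mul0r mxtrace0 addr0.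
have e3 : mpoly.mderiv (iZ i j) (\tr (Zmx * Wmx)) = Wmx j i.
  by rewrite mderiv_tr_mul mderiv_Zmx mderiv_Z_Wmx mul0r mxtrace0 addr0 tr_delta_mul.
apply: (etrans (mderiv_comb3 _ _ _ e1 e2 e3)).
by rewrite scaler0 addr0 scale2_half.
Qed.

Lemma mderiv_gauss_form_W a1 a2 g i j :
  mpoly.mderiv (iW i j) (gauss_form a1 a2 g) = a2 *: Wmx j i + g *: Zmx j i.
Proof.
have e1 : mpoly.mderiv (iW i j) (\tr (Zmx * Zmx)) = 0.
  by rewrite mderiv_tr_mul mderiv_W_Zmx mul0r mxtrace0 addr0.
have e2 : mpoly.mderiv (iW i j) (\tr (Wmx * Wmx)) = Wmx j i + Wmx j i.
  by rewrite mderiv_tr_mul mderiv_Wmx tr_delta_mul.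
have e3 : mpoly.mderiv (iW i j) (\tr (Zmx * Wmx)) = Zmx j i.
  by rewrite mderiv_tr_mul mderiv_Wmx mderiv_W_Zmx mul0r mxtrace0 add0r tr_delta_mul.
apply: (etrans (mderiv_comb3 _ _ _ e1 e2 e3)).
by rewrite scaler0 add0r scale2_half.
Qed.

(** [A] and [B] are arbitrary, not adjoint to each other, because the mean takes a function of two
    independent matrices. The transpose of [B] undoes the transposed index of [iW]. *)
Definition evm (A B : 'M[C]_n) (P : poly) : C :=
  mpoly.meval (fun a => match fintype.split a with
    | inl p => mxvec A 0 p | inr p => mxvec B^T 0 p end) P.

Lemma evm_Zmx A B : map_mx (evm A B) Zmx = A.
Proof. by apply/matrixP => i j; rewrite mxE ZmxE /evm mpoly.mevalXU split_lshift mxvecE. Qed.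
Lemma evm_Wmx A B : map_mx (evm A B) Wmx = B.
Proof. by apply/matrixP => i j; rewrite mxE WmxE /evm mpoly.mevalXU split_rshift mxvecE mxE. Qed.

Lemma evm_tuple (x : N.-tuple T) P :
  evm (mx_of_tuple x) ((mx_of_tuple x) ^t*) P = ev lin x P.
Proof.
apply: mpoly.meval_eq => a; rewrite -(splitK a); case: (fintype.split a) => p /=.
  by rewrite split_lshift; case/mxvec_indexP: p => i j; rewrite mxvecE -linear_vars_iZ.
by rewrite split_rshift; case/mxvec_indexP: p => i j; rewrite mxvecE mxE -linear_vars_iW.
Qed.

End matrix_variables.

(** * The convergence domain and coercivity of the exponent *)

Section gauss_domain.
Context {R : realType}.
Local Notation C := R[i].

Lemma polar_unit (x y : R) : x ^+ 2 + y ^+ 2 = 1 -> exists t, cos t = x /\ sin t = y.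
Proof.
move=> xy1; have x1 : -1 <= x <= 1.
  by rewrite -ler_norml -(@expr_le1 _ 2)// real_normK ?num_real// -xy1 lerDl sqr_ge0.
have e : Num.sqrt (1 - x ^+ 2) = `|y| by rewrite -xy1 addrC addKr sqrtr_sqr.
have [y0|y0] := leP 0 y.
  by exists (acos x); rewrite acosK// sin_acos// e ger0_norm.
exists (- acos x); rewrite cosN sinN acosK// sin_acos// e ltr0_norm//.
by rewrite opprK.
Qed.

Lemma Re_mul_cis (u : C) (t : R) :
  Re (u * cexp (0 +i* t)) = Re u * cos t - Im u * sin t.
Proof. by rewrite Re_mul /cexp /= expR0; ring. Qed.

(** A number and its conjugate have the same real part; conjugating the term in [a2] leaves a single
    phase. *)
Lemma Re_gauss_domain (a1 a2 g : C) (t : R) :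
  Re (a1 * cexp (0 +i* t) + a2 * cexp (0 -i* t) + 2 * g) =
  Re ((a1 + Num.conj a2) * cexp (0 +i* t)) + 2 * Re g.
Proof.
rewrite conjE /cexp /= expR0 cosN sinN.
by rewrite ?(Re_add, Im_add, Re_mul, Im_mul) /=; ring.
Qed.

(** As the phase varies, the minimum of Re (u e^(it)) is - |u|. *)
Lemma gauss_domainP (a1 a2 g : C) :
  gauss_domain a1 a2 g <-> normc (a1 + Num.conj a2) < 2 * Re g.
Proof.
rewrite /gauss_domain; set u := a1 + Num.conj a2; split => [h|h t]; last first.
  rewrite Re_gauss_domain -ltrBlDr sub0r.
  apply: (lt_le_trans (_ : _ < - normc u)); first by rewrite ltrN2.
  have := normc_ge_absRe (u * cexp (0 +i* t)).
  by rewrite Normc.normcM normc_cexp /= expR0 mulr1 ler_norml => /andP[].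
have {}h t : 0 < Re (u * cexp (0 +i* t)) + 2 * Re g by rewrite -Re_gauss_domain.
have [u0|u0] := eqVneq (normc u) 0.
  by have := h 0; rewrite u0 (Normc.eq0_normc u0) mul0r add0r.
have ugt0 : 0 < normc u by rewrite lt_def u0 normc_ge0.
have uE : Re u ^+ 2 + Im u ^+ 2 = normc u ^+ 2.
  by case: (u) => p q /=; rewrite sqr_sqrtr// addr_ge0 ?sqr_ge0.
(* The minimizing phase is e^(it) = - conj u / |u|. *)
have [|t [ct st]] := @polar_unit (- Re u / normc u) (Im u / normc u).
  by rewrite !expr_div_n sqrrN -mulrDl uE divff// expf_neq0.
have := h t; rewrite Re_mul_cis ct st.
have -> : Re u * (- Re u / normc u) - Im u * (Im u / normc u) = - normc u.
  have -> : normc u = normc u ^+ 2 / normc u by rewrite expr2 mulfK.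
  by rewrite -[in RHS]uE; field.
by rewrite addrC subr_gt0.
Qed.

End gauss_domain.

Section quadratic_form.
Context {R : realType} (n : nat).
Local Notation C := R[i].
Local Notation T := (measurableTypeR R).
Local Notation N := (n * n + n * n)%N.
Local Notation poly := (mpoly.mpoly N C).
Local Notation lin := (@lin R n).
Local Notation Zmx := (Zmx R n).
Local Notation Wmx := (Wmx R n).
Local Notation gauss_form := (@gauss_form R n).

Lemma evm_mxM (A B : 'M[C]_n) (X Y : 'M[poly]_n) :
  map_mx (evm A B) (X * Y) = map_mx (evm A B) X * map_mx (evm A B) Y.
Proof. exact: (map_mxM (mpoly.meval _)). Qed.

Lemma evm_tr (A B : 'M[C]_n) (X : 'M[poly]_n) :
  evm A B (\tr X) = \tr (map_mx (evm A B) X).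
Proof. by rewrite (trace_map_mx (mpoly.meval _)). Qed.

Lemma evm_comb3 (A B : 'M[C]_n) (c1 c2 c3 v1 v2 v3 : C) (P1 P2 P3 : poly) :
  evm A B P1 = v1 -> evm A B P2 = v2 -> evm A B P3 = v3 ->
  evm A B (c1 *: P1 + c2 *: P2 + c3 *: P3) = c1 * v1 + c2 * v2 + c3 * v3.
Proof.
move=> <- <- <-; rewrite /evm !mpoly.mevalD.
by congr (_ + _ + _); exact: mpoly.mevalZ.
Qed.

Lemma evm_gauss_form (A B : 'M[C]_n) (a1 a2 g : C) : evm A B (gauss_form a1 a2 g) =
  a1 / 2 * \tr (A * A) + a2 / 2 * \tr (B * B) + g * \tr (A * B).
Proof.
by apply: evm_comb3; rewrite evm_tr evm_mxM ?evm_Zmx ?evm_Wmx.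
Qed.

Lemma sum_mxvec_index (F : 'I_(n * n) -> R) :
  \sum_p F p = \sum_i \sum_j F (mxvec_index i j).
Proof.
rewrite (reindex _ (curry_mxvec_bij n n)) /= pair_bigA /=.
by apply: eq_bigr => -[i j].
Qed.

Lemma norm2E (x : N.-tuple T) : norm2 x = \sum_i \sum_j normc (mx_of_tuple x i j) ^+ 2.
Proof.
rewrite /norm2 big_split_ord /= !sum_mxvec_index -big_split /=.
apply: eq_bigr => i _; rewrite -big_split /=; apply: eq_bigr => j _.
by rewrite mxE /= sqr_sqrtr// addr_ge0 ?sqr_ge0.
Qed.

Lemma Re_sum (I : Type) (r : seq I) (F : I -> C) :
  Re (\sum_(i <- r) F i) = \sum_(i <- r) Re (F i).
Proof. by apply: big_morph => //; exact: Re_add. Qed.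

(** With u = a1 + conj a2, the first two terms have real part Re (u z w) / 2, which is at least -
    |u| |z| |w| / 2, and |z| |w| <= (|z|^2 + |w|^2) / 2. It is meant for z = Z_ij and w = Z_ji. *)
Lemma Re_form_ge (a1 a2 g : C) (z w : C) :
  Re g * normc z ^+ 2 - normc (a1 + Num.conj a2) / 4 * (normc z ^+ 2 + normc w ^+ 2) <=
  Re (a1 / 2 * (z * w) + a2 / 2 * (Num.conj w * Num.conj z) + g * (z * Num.conj z)).
Proof.
set u := a1 + _.
have -> : Re (a1 / 2 * (z * w) + a2 / 2 * (Num.conj w * Num.conj z) + g * (z * Num.conj z))
  = Re (u * (z * w)) / 2 + Re g * normc z ^+ 2.
  rewrite /u !conjE.
  have V2 : (2 : C)^-1 = (2^-1)%:C.
    by rewrite -[2 in LHS]/(2%:R) -(rmorph_nat (real_complex R)) fmorphV.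
  rewrite V2; case: z => p q; case: w => s t; case: (a1) => b b'; case: (a2) => d d'; case: (g) => e e'.
  rewrite /= sqr_sqrtr ?addr_ge0 ?sqr_ge0//.
  by field.
rewrite addrC lerD2r.
have h1 := normc_ge_absRe (u * (z * w)).
rewrite !Normc.normcM in h1.
have h2 : normc z * normc w <= (normc z ^+ 2 + normc w ^+ 2) / 2.
  by have := sqr_ge0 (normc z - normc w); rewrite sqrrB; lra.
have h3 : normc u * (normc z * normc w) <= normc u * ((normc z ^+ 2 + normc w ^+ 2) / 2).
  by rewrite ler_wpM2l// normc_ge0.
move: h1; rewrite ler_norml => /andP[h1 _].
by move: h3; set r := normc z ^+ 2 + _; rewrite mulrA; lra.
Qed.

(** In the sum of the entrywise bounds each |Z_ij|^2 is charged |u| / 4 twice, at (i, j) and at (j,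
    i), which leaves the constant Re g - |u| / 2. *)
Lemma gauss_form_coercive (a1 a2 g : C) : normc (a1 + Num.conj a2) < 2 * Re g ->
  coercive lin ((2 * Re g - normc (a1 + Num.conj a2)) / 2) (gauss_form a1 a2 g).
Proof.
set u := normc _ => hu; split; first by rewrite divr_gt0// subr_gt0.
move=> x; rewrite -evm_tuple evm_gauss_form; set Z := mx_of_tuple x.
have nE := norm2E x.
have nE' : norm2 x = \sum_i \sum_j normc (Z j i) ^+ 2 by rewrite nE exchange_big.
have -> : a1 / 2 * \tr (Z * Z) + a2 / 2 * \tr (Z^t* * Z^t*) + g * \tr (Z * Z^t*) =
  \sum_i \sum_j (a1 / 2 * (Z i j * Z j i)
     + a2 / 2 * (Num.conj (Z j i) * Num.conj (Z i j)) + g * (Z i j * Num.conj (Z i j))).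
  rewrite /mxtrace !mulr_sumr -!big_split /=; apply: eq_bigr => i _.
  rewrite !mxE !mulr_sumr -!big_split /=; apply: eq_bigr => j _.
  by rewrite !mxE.
rewrite Re_sum; under eq_bigr do rewrite Re_sum.
apply: (@le_trans _ _ (\sum_i \sum_j (Re g * normc (Z i j) ^+ 2 -
   u / 4 * (normc (Z i j) ^+ 2 + normc (Z j i) ^+ 2)))); last first.
  by apply: ler_sum => i _; apply: ler_sum => j _; exact: Re_form_ge.
under eq_bigr do rewrite sumrB -!mulr_sumr big_split.
rewrite sumrB -!mulr_sumr big_split /= -nE -nE'.
by lra.
Qed.

End quadratic_form.

(** * Loop equations and the normalization *)

Section abstract_loop_equations.
Variables (K A : comNzRingType) (n : nat) (E : A -> K) (a1 a2 g : K).
Variables (Z W : 'M[A]_n) (dZ dW : 'I_n -> 'I_n -> A -> A).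
Hypothesis E_add : {morph E : x y / x + y}.
Hypothesis E_dZ : forall i j P,
  a1 * E (P * Z j i) + g * E (P * W j i) = E (dZ i j P).
Hypothesis E_dW : forall i j P,
  a2 * E (P * W j i) + g * E (P * Z j i) = E (dW i j P).

Let E0 : E 0 = 0.
Proof. by apply: (addrI (E 0)); rewrite -E_add !addr0. Qed.

Let E_sum2 (F : 'I_n -> 'I_n -> A) :
  E (\sum_i \sum_j F i j) = \sum_i \sum_j E (F i j).
Proof.
rewrite (big_morph E E_add E0); apply: eq_bigr => i _.
by rewrite (big_morph E E_add E0).
Qed.

Lemma mul_tr_sum2 (P : A) (X F : 'M[A]_n) :
  P * \tr (X * F) = \sum_i \sum_j P * F i j * X j i.
Proof.
rewrite exchange_big /= /mxtrace mulr_sumr; apply: eq_bigr => j _.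
rewrite mxE mulr_sumr; apply: eq_bigr => i _.
by rewrite (mulrC (X j i)) mulrA.
Qed.

Let E_mul_tr (P : A) (X F : 'M[A]_n) :
  E (P * \tr (X * F)) = \sum_i \sum_j E (P * F i j * X j i).
Proof. by rewrite mul_tr_sum2 E_sum2. Qed.

Let comb_sum2 (b d : K) (x y z : 'I_n -> 'I_n -> K) :
  (forall i j, b * x i j + d * y i j = z i j) ->
  b * (\sum_i \sum_j x i j) + d * (\sum_i \sum_j y i j) = \sum_i \sum_j z i j.
Proof.
move=> h; rewrite !mulr_sumr -big_split; apply: eq_bigr => i _.
by rewrite /= !mulr_sumr -big_split; apply: eq_bigr => j _; exact: h.
Qed.

(** The entrywise equation for P F_ij, summed over i and j: the products F_ij X_ji assemble into the
    trace of X F. *)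
Lemma loop_equation_Z (P : A) (F : 'M[A]_n) :
  a1 * E (P * \tr (Z * F)) + g * E (P * \tr (W * F)) =
  E (\sum_i \sum_j dZ i j (P * F i j)).
Proof. by rewrite !E_mul_tr E_sum2; apply: comb_sum2 => i j; exact: E_dZ. Qed.

Lemma loop_equation_W (P : A) (F : 'M[A]_n) :
  a2 * E (P * \tr (W * F)) + g * E (P * \tr (Z * F)) =
  E (\sum_i \sum_j dW i j (P * F i j)).
Proof. by rewrite !E_mul_tr E_sum2; apply: comb_sum2 => i j; exact: E_dW. Qed.

Hypothesis dZ_Z : forall i j, map_mx (dZ i j) Z = delta_mx i j.
Hypothesis dZ_W : forall i j, map_mx (dZ i j) W = 0.
Hypothesis dW_W : forall i j, map_mx (dW i j) W = delta_mx i j.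
Hypothesis dW_Z : forall i j, map_mx (dW i j) Z = 0.

Let E_sum2_cst (P : A) : E (\sum_(i < n) \sum_(j < n) P) = (n ^ 2)%:R * E P.
Proof.
rewrite E_sum2; under eq_bigr do rewrite sumr_const card_ord.
by rewrite sumr_const card_ord -mulrnA mulr_natl.
Qed.

Let sum_delta (d : 'I_n -> 'I_n -> A -> A) (X : 'M[A]_n) :
  (forall i j, map_mx (d i j) X = delta_mx i j) ->
  \sum_i \sum_j d i j (1 * X i j) = \sum_(i < n) \sum_(j < n) 1.
Proof.
move=> h; apply: eq_bigr => i _; apply: eq_bigr => j _.
by have /matrixP/(_ i j) := h i j; rewrite !mxE !eqxx mul1r.
Qed.

Let sum_null (d : 'I_n -> 'I_n -> A -> A) (X : 'M[A]_n) :
  (forall i j, map_mx (d i j) X = 0) -> \sum_i \sum_j d i j (1 * X i j) = 0.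
Proof.
move=> h; rewrite big1// => i _; rewrite big1// => j _.
by have /matrixP/(_ i j) := h i j; rewrite !mxE mul1r.
Qed.

(** The loop equations with P = 1 and F = Z or W; n^2 counts the derivatives of entries by
    themselves. The result is left multiplied by [d], whose nonvanishing on the domain will be
    deduced from these very equations. *)
Lemma quadratic_moments : let d := a1 * a2 - g ^+ 2 in
  [/\ d * E (\tr (Z * Z)) = (n ^ 2)%:R * a2 * E 1,
      d * E (\tr (W * W)) = (n ^ 2)%:R * a1 * E 1 &
      d * E (\tr (Z * W)) = - (n ^ 2)%:R * g * E 1].
Proof.
have WZ : \tr (W * Z) = \tr (Z * W) by exact: mxtrace_mulC.
have e1 := loop_equation_Z 1 Z; rewrite (sum_delta dZ_Z) E_sum2_cst !mul1r WZ in e1.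
have e2 := loop_equation_Z 1 W; rewrite (sum_null dZ_W) E0 !mul1r in e2.
have e3 := loop_equation_W 1 W; rewrite (sum_delta dW_W) E_sum2_cst !mul1r in e3.
have e4 := loop_equation_W 1 Z; rewrite (sum_null dW_Z) E0 !mul1r WZ in e4.
move: e1 e2 e3 e4; move: (E 1) (E (\tr (Z * Z))) (E (\tr (W * W))) (E (\tr (Z * W))).
move=> D x y w e1 e2 e3 e4; split.
- have -> : (a1 * a2 - g ^+ 2) * x = a2 * (a1 * x + g * w) - g * (a2 * w + g * x) by ring.
  by rewrite e1 e4; ring.
- have -> : (a1 * a2 - g ^+ 2) * y = a1 * (a2 * y + g * w) - g * (a1 * w + g * y) by ring.
  by rewrite e2 e3; ring.
- have -> : (a1 * a2 - g ^+ 2) * w = a2 * (a1 * w + g * y) - g * (a2 * y + g * w) by ring.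
  by rewrite e2 e3; ring.
Qed.

End abstract_loop_equations.

Section normalization.
Context {R : realType} (n : nat).
Local Notation C := R[i].
Local Notation T := (measurableTypeR R).
Local Notation N := (n * n + n * n)%N.
Local Notation poly := (mpoly.mpoly N C).
Local Notation lin := (@lin R n).
Local Notation Zmx := (Zmx R n).
Local Notation Wmx := (Wmx R n).
Local Notation gauss_form := (@gauss_form R n).

Section schwinger_dyson_matrix.
Variables (c : R) (a1 a2 g : C).
Hypothesis cq : coercive lin c (gauss_form a1 a2 g).
Let q := gauss_form a1 a2 g.

Lemma schwinger_dyson_Z i j (P : poly) :
  a1 * gint lin q (P * Zmx j i) + g * gint lin q (P * Wmx j i) =
  gint lin q (mpoly.mderiv (iZ i j) P).
Proof.
rewrite -(schwinger_dyson cq P (Linv := @lin_inv R n)) => [|b]; last exact: lin_invK.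
rewrite mderiv_gauss_form_Z mulrDr -!scalerAr (gintD cq).
by congr (_ + _); rewrite (gintZ cq).
Qed.

Lemma schwinger_dyson_W i j (P : poly) :
  a2 * gint lin q (P * Wmx j i) + g * gint lin q (P * Zmx j i) =
  gint lin q (mpoly.mderiv (iW i j) P).
Proof.
rewrite -(schwinger_dyson cq P (Linv := @lin_inv R n)) => [|b]; last exact: lin_invK.
rewrite mderiv_gauss_form_W mulrDr -!scalerAr (gintD cq).
by congr (_ + _); rewrite (gintZ cq).
Qed.

Lemma schwinger_dyson_tr_Z (P : poly) (F : 'M[poly]_n) :
  a1 * gint lin q (P * \tr (Zmx * F)) + g * gint lin q (P * \tr (Wmx * F)) =
  gint lin q (\sum_i \sum_j mpoly.mderiv (iZ i j) (P * F i j)).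
Proof. exact: (loop_equation_Z (gintD cq) schwinger_dyson_Z). Qed.

Lemma schwinger_dyson_tr_W (P : poly) (F : 'M[poly]_n) :
  a2 * gint lin q (P * \tr (Wmx * F)) + g * gint lin q (P * \tr (Zmx * F)) =
  gint lin q (\sum_i \sum_j mpoly.mderiv (iW i j) (P * F i j)).
Proof. exact: (loop_equation_W (gintD cq) schwinger_dyson_W). Qed.

Lemma gint_quadratic : let d := a1 * a2 - g ^+ 2 in
  [/\ d * gint lin q (\tr (Zmx * Zmx)) = (n ^ 2)%:R * a2 * gint lin q 1,
      d * gint lin q (\tr (Wmx * Wmx)) = (n ^ 2)%:R * a1 * gint lin q 1 &
      d * gint lin q (\tr (Zmx * Wmx)) = - (n ^ 2)%:R * g * gint lin q 1].
Proof.
exact: (quadratic_moments (gintD cq) schwinger_dyson_Z schwinger_dyson_W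
  (@mderiv_Zmx R n) (@mderiv_Z_Wmx R n) (@mderiv_Wmx R n) (@mderiv_W_Zmx R n)).
Qed.

End schwinger_dyson_matrix.

Lemma coercive_le c c' (P : poly) : 0 < c' -> c' <= c -> coercive lin c P ->
  coercive lin c' P.
Proof.
move=> c'0 cc' [c0 h]; split=> // x; rewrite (le_trans _ (h x))//.
by rewrite ler_wpM2r ?norm2_ge0.
Qed.

(** At (0, 0, 1) the weight is exp (- |x|^2), a multiple [K] of a product of normal densities of
    mass 1, so the integral has real part [K]. *)
Lemma gint_base_neq0 : gint lin (gauss_form 0 0 1) 1 != 0.
Proof.
have E (x : N.-tuple T) : ev lin x (gauss_form 0 0 1) = (norm2 x)%:C.
  rewrite -evm_tuple evm_gauss_form !mul0r !add0r mul1r norm2E.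
  rewrite raddf_sum /=; apply: eq_bigr => i _; rewrite mxE raddf_sum /=.
  apply: eq_bigr => j _; rewrite !mxE.
  by rewrite conjE; apply: complex_ext; rewrite ?(Re_mul, Im_mul) /= ?sqr_sqrtr ?addr_ge0 ?sqr_ge0//; ring.
have [K K0 hK] := gauss_gprod (R := R) N (c := 1) ltr01.
suff : Re (gint lin (gauss_form 0 0 1) 1) = K.
  (* Only [0 <= K] is known so far; [K = 0] would make an exponential vanish at the origin. *)
  move=> e; apply/eqP => e0; move: e; rewrite e0 /= => e.
  have := hK (nseq_tuple N 0); rewrite -e mul0r => /eqP.
  by rewrite gt_eqF ?expR_gt0.
rewrite gint.unlock -[LHS]/(\int[lebesgue_tuple R N]_x Re (ev lin x 1 * weight lin (gauss_form 0 0 1) x)).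
transitivity (\int[lebesgue_tuple R N]_x (K * gprod (gdev 1) x)).
  apply: eq_Rintegral => x _; rewrite -hK /weight E /ev mpoly.meval1 mul1r mul1r.
  by rewrite /cexp Re_mul /= oppr0 cos0 sin0 mulr1 mul0r subr0.
rewrite RintegralZl//; last exact: integrable_gprod.
by rewrite /Rintegral integral_gprod mulr1.
Qed.

End normalization.

Section nonvanishing.
Context {R : realType}.
Local Notation C := R[i].

Lemma is_cderiveX (x : R) (f : R -> C) d k : is_cderive x f d ->
  is_cderive x (fun y => f y ^+ k.+1) (k.+1%:R * f x ^+ k * d).
Proof.
move=> fd; elim: k => [|k IH].
  under eq_fun do rewrite expr1.
  by rewrite expr0 !mul1r.
under eq_fun do rewrite exprS.
apply: (is_cderive_eq (is_cderiveM fd IH)).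
rewrite exprS -(natr1 k.+1); move: (f x) (f x ^+ k) => u v; ring.
Qed.

Lemma is_cderive_id (x : R) : is_cderive x (fun y => y%:C) 1.
Proof. by apply: (is_cderive_real (u := id)); exact: is_derive_id. Qed.

Lemma gint_comb3 m M (L : 'I_M -> 'I_m -> C) c (q : mpoly.mpoly M C) (c1 c2 c3 : C)
    (P1 P2 P3 : mpoly.mpoly M C) : coercive L c q ->
  gint L q (c1 *: P1 + c2 *: P2 + c3 *: P3) =
  c1 * gint L q P1 + c2 * gint L q P2 + c3 * gint L q P3.
Proof. by move=> cq; rewrite !(gintD cq) !(gintZ cq). Qed.

Lemma comb3_affine (V : lmodType C) (a1 a2 g s : C) (P1 P2 P3 : V) :
  (s * a1 / 2) *: P1 + (s * a2 / 2) *: P2 + (1 + s * (g - 1)) *: P3 =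
  (0 / 2) *: P1 + (0 / 2) *: P2 + 1 *: P3 +
  s *: ((a1 / 2) *: P1 + (a2 / 2) *: P2 + (g - 1) *: P3).
Proof.
rewrite mul0r !scale0r !add0r !scalerDr !scalerA scalerDl !mulrA.
by rewrite addrCA.
Qed.

(** The factor in parentheses on the right is the derivative in t of the discriminant t^2 a1 a2 - (1
    + t (g - 1))^2 along the segment. *)
Lemma quadratic_combination (a1 a2 g t k d x y w dd : C) :
  dd * x = k * (t * a2) * d -> dd * y = k * (t * a1) * d ->
  dd * w = - k * (1 + t * (g - 1)) * d ->
  2 * (dd * (a1 / 2 * x + a2 / 2 * y + (g - 1) * w)) =
  k * (2 * t * (a1 * a2 - (g - 1) ^+ 2) + - 2 * (g - 1)) * d.
Proof.
move=> hx hy hw.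
have -> : 2 * (dd * (a1 / 2 * x + a2 / 2 * y + (g - 1) * w)) =
  a1 * (dd * x) + a2 * (dd * y) + 2 * (g - 1) * (dd * w) by field.
by rewrite hx hy hw; ring.
Qed.

Variables (n : nat).
Hypothesis n_gt0 : (0 < n)%N.
Local Notation lin := (@lin R n).
Local Notation gauss_form := (@gauss_form R n).

(** The exponent is affine along the segment from (0, 0, 1) to (a1, a2, g), as differentiation in
    the parameter requires. *)
Lemma gauss_form_segment (a1 a2 g s : C) :
  gauss_form (s * a1) (s * a2) (1 + s * (g - 1)) =
  gauss_form 0 0 1 + s *: gauss_form a1 a2 (g - 1).
Proof. exact: comb3_affine. Qed.

(** Points of the segment are convex combinations of two points of the domain. The margin [e] beyond
    both ends makes two-sided derivatives available at 0 and 1, and [c] is the same for all [s]. *)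
Lemma gauss_segment_coercive (a1 a2 g : C) : normc (a1 + Num.conj a2) < 2 * Re g ->
  exists c e : R, 0 < e /\ forall s : R, s \in `]- e, (1 + e)[ ->
    coercive lin c (gauss_form (s%:C * a1) (s%:C * a2) (1 + s%:C * (g - 1))).
Proof.
move=> hu; set u := normc _ in hu; set ga := Re g in hu.
have u0 : 0 <= u := normc_ge0 _.
(* Twice the coercivity constant at [s] is 2 (1 + s (ga - 1)) - |s| u. For 0 <= s <= 1 it is at
   least min(2, 2 ga - u); for s > 1 the loss is at most 2 e; for s < 0 the loss is at most e K. The
   bounds on [e] keep half of each margin. *)
pose K := 2 * ga + u; have K0 : 0 < K by rewrite /K; lra.
pose e := Num.min ((2 * ga - u) / 4) K^-1.
have e0 : 0 < e by rewrite lt_min invr_gt0 K0 andbT; lra.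
have e1 : e <= (2 * ga - u) / 4 by rewrite ge_min lexx.
have e2 : e * K <= 1 by rewrite -ler_pdivlMr// div1r ge_min lexx orbT.
pose c := Num.min 1 ((2 * ga - u) / 2) / 2.
have c0 : 0 < c by rewrite /c divr_gt0// lt_min ltr01 /=; lra.
have c1 : c * 2 <= 1 by rewrite /c divfK ?pnatr_eq0// ge_min lexx.
have c2 : c * 2 <= (2 * ga - u) / 2 by rewrite /c divfK ?pnatr_eq0// ge_min lexx orbT.
exists c, e; split=> // s; rewrite in_itv/= => /andP[s1 s2].
have gE : Re (1 + s%:C * (g - 1)) = 1 + s * (ga - 1).
  by rewrite /ga; case: (g) => p q /=; ring.
have uE : normc (s%:C * a1 + Num.conj (s%:C * a2)) = `|s| * u.
  have -> : s%:C * a1 + Num.conj (s%:C * a2) = s%:C * (a1 + Num.conj a2).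
    by rewrite !conjE; case: (a1) => p q; case: (a2) => r t; apply: complex_ext => /=; ring.
  by rewrite Normc.normcM normc_real.
have key : c * 2 <= 2 * (1 + s * (ga - 1)) - `|s| * u.
  have [s0|s0] := leP 0 s.
    rewrite ger0_norm//; have [h|h] := leP s 1; first by nra.
    have : s * (2 * ga - u) >= 2 * ga - u by nra.
    by lra.
  rewrite ltr0_norm//; have : - s * K <= 1 by nra.
  by rewrite /K; nra.
have hs : normc (s%:C * a1 + Num.conj (s%:C * a2)) < 2 * Re (1 + s%:C * (g - 1)).
  by rewrite uE gE; lra.
apply: (coercive_le c0 _ (gauss_form_coercive n hs)).
by rewrite uE gE ler_pdivlMr.
Qed.

(** Along the segment D' = - H, and the quadratic moments give 2 dl H = n^2 dl' D, so
    [D * D * dl ^+ (n ^ 2)] has derivative 0. No division by [dl] occurs, hence its nonvanishing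
    comes out as part of the conclusion. *)
Lemma gauss_integral_neq0 (a1 a2 g : C) : normc (a1 + Num.conj a2) < 2 * Re g ->
  gint lin (gauss_form a1 a2 g) 1 != 0 /\ a1 * a2 - g ^+ 2 != 0.
Proof.
move=> hu; have [c [e [e0 hc]]] := gauss_segment_coercive hu.
pose h := gauss_form a1 a2 (g - 1); pose q0 := gauss_form 0 0 1.
pose D (s : R) : C := gint lin (q0 + s%:C *: h) 1.
pose H (s : R) : C := gint lin (q0 + s%:C *: h) (1 * h).
pose A : C := a1 * a2 - (g - 1) ^+ 2; pose B : C := - 2 * (g - 1).
pose dl (s : R) : C := s%:C * (s%:C * A + B) - 1.
have qE (s : R) : q0 + s%:C *: h = gauss_form (s%:C * a1) (s%:C * a2) (1 + s%:C * (g - 1)).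
  by rewrite gauss_form_segment.
have cqs (s : R) : s \in `]- e, (1 + e)[ -> coercive lin c (q0 + s%:C *: h).
  by move=> hs; rewrite qE; exact: hc.
have dD (s : R) : s \in `]- e, (1 + e)[ -> is_cderive s D (- H s).
  by move=> hs; exact: (gint_cderive 1 cqs hs).
have poly_derive (t a b : C) :
    1 * (t * a + b) + t * (1 * a + t * 0 + 0) + 0 = 2 * t * a + b by ring.
have ddl (s : R) : is_cderive s dl (2 * s%:C * A + B).
  rewrite /dl; apply: is_cderive_eq.
    apply: is_cderiveD; last exact: is_cderive_cst.
    apply: (is_cderiveM (is_cderive_id s)).
    apply: is_cderiveD; last exact: is_cderive_cst.
    by apply: (is_cderiveM (is_cderive_id s)); exact: is_cderive_cst.
  exact: poly_derive.
have dlE (s : R) : dl s = s%:C * a1 * (s%:C * a2) - (1 + s%:C * (g - 1)) ^+ 2.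
  by rewrite /dl /A /B; move: (s%:C) => t; ring.
have HE (s : R) : s \in `]- e, (1 + e)[ ->
    2 * (dl s * H s) = (n ^ 2)%:R * (2 * s%:C * A + B) * D s.
  move=> hs; have cs := hc s hs.
  have [m1 m2 m3] := gint_quadratic cs.
  rewrite /H /D mul1r qE (gint_comb3 _ _ _ _ _ _ cs) dlE.
  exact: (quadratic_combination m1 m2 m3).
(* Writing n^2 as a successor gives the derivative of the power its exponent [k], and lets a nonzero
   power of the discriminant imply a nonzero discriminant at the end. *)
have [k kE] : exists k, (n ^ 2)%N = k.+1.
  by exists (n ^ 2).-1; rewrite prednK// expn_gt0 n_gt0.
pose G (s : R) : C := D s * D s * dl s ^+ k.+1.
have GE : G 0 = G 1.
  apply: is_cderive_segment_cst => // s; rewrite in_itv/= => /andP[s0 s1].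
  have hs : s \in `]- e, (1 + e)[ by rewrite in_itv/=; apply/andP; split; lra.
  apply: (is_cderive_eq (is_cderiveM (is_cderiveM (dD s hs) (dD s hs))
     (is_cderiveX k (ddl s)))).
  have := HE s hs; rewrite kE exprS.
  move: (H s) (D s) (dl s) (2 * s%:C * A + B) (k.+1%:R) => x d l l' kk hh.
  have -> : (- x * d + d * - x) * (l * l ^+ k) + d * d * (kk * l ^+ k * l') =
     d * l ^+ k * (kk * l' * d - 2 * (l * x)) by ring.
  by rewrite hh subrr mulr0.
have D0 : D 0 != 0 by rewrite /D scale0r addr0; exact: gint_base_neq0.
have dl0 : dl 0 != 0 by rewrite /dl mul0r add0r oppr_eq0 oner_eq0.
have : G 1 != 0 by rewrite -GE !mulf_neq0// expf_neq0.
have -> : G 1 = gint lin (gauss_form a1 a2 g) 1 ^+ 2 * (a1 * a2 - g ^+ 2) ^+ k.+1.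
  rewrite /G /D qE dlE expr2 !mul1r.
  by have -> : 1 + (g - 1) = g by ring.
by rewrite mulf_eq0 !expf_eq0 /= negb_or => /andP[-> ->].
Qed.

End nonvanishing.

(** * Polynomial moments *)

Section univariate_restriction.
Context {F : fieldType}.

(** Along a curve whose coordinates are rational in [t] with common denominator [d], a large enough
    power of [d] turns the values of [P] into those of one univariate polynomial. *)
Lemma meval_clear_denominators k (l : 'I_k -> {poly F}) (d : {poly F}) (P : mpoly.mpoly k F) :
  exists N p, forall t, d.[t] != 0 ->
    p.[t] = d.[t] ^+ N * mpoly.meval (fun i => (l i).[t] / d.[t]) P.
Proof.
elim/mpoly_ring_ind: P => [c|i|P Q [N [p hp]] [N' [p' hp']]|P Q [N [p hp]] [N' [p' hp']]].
- by exists 0, c%:P => t _; rewrite hornerC mpoly.mevalC mul1r.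
- by exists 1, (l i) => t dt; rewrite expr1 mpoly.mevalXU mulrC divfK.
- exists (N + N')%N, (p * d ^+ N' + p' * d ^+ N) => t dt.
  rewrite hornerD !hornerM !horner_exp hp// hp'// mpoly.mevalD exprD.
  by ring.
- exists (N + N')%N, (p * p') => t dt.
  by rewrite hornerM hp// hp'// mpoly.mevalM exprD; ring.
Qed.

Lemma poly_eq0_infinite_roots (p : {poly F}) (s : nat -> F) :
  injective s -> (forall i, root p (s i)) -> p = 0.
Proof.
move=> si ps; apply/eqP; case: (eqVneq p 0) => // p0.
have := max_poly_roots p0 (rs := map s (iota 0 (size p))).
rewrite size_map size_iota ltnn => -> //.
  by apply/allP => _ /mapP[i _ ->].
by rewrite map_inj_uniq ?iota_uniq.
Qed.

End univariate_restriction.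

Section gauss_mean_theory.
Context {R : realType}.
Local Notation C := R[i].

(** The segment from (0, 0, 1) to the given point, which may lie outside the domain, stays in the
    domain for small positive times. The cleared polynomial thus has infinitely many roots, is zero,
    and is read off at t = 1. *)
Lemma eval_over_delta_ext0 (T : mpoly.mpoly 3 C) :
  (forall a1 a2 g, gauss_domain a1 a2 g -> eval_over_delta T a1 a2 g = 0) ->
  forall a1 a2 g, a1 * a2 - g ^+ 2 != 0 -> eval_over_delta T a1 a2 g = 0.
Proof.
move=> hT a1 a2 g dn0.
pose l1 : {poly C} := a1 *: 'X; pose l2 : {poly C} := a2 *: 'X.
pose l3 : {poly C} := 1 + (g - 1) *: 'X.
pose d := l1 * l2 - l3 ^+ 2.
have l1E t : l1.[t] = t * a1 by rewrite /l1 hornerZ hornerX mulrC.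
have l2E t : l2.[t] = t * a2 by rewrite /l2 hornerZ hornerX mulrC.
have l3E t : l3.[t] = 1 + t * (g - 1) by rewrite /l3 !hornerE mulrC.
have dE t : d.[t] = t * a1 * (t * a2) - (1 + t * (g - 1)) ^+ 2.
  by rewrite /d hornerD hornerN hornerM horner_exp l1E l2E l3E.
have [N [p hp]] := meval_clear_denominators (tnth [tuple l1; l2; l3]) d T.
have evE t : d.[t] != 0 ->
    p.[t] = d.[t] ^+ N * eval_over_delta T (t * a1) (t * a2) (1 + t * (g - 1)).
  move=> dt; rewrite (hp t dt) /eval_over_delta; apply: (f_equal (fun z => _ * z)).
  apply: mpoly.meval_eq => i.
  rewrite -dE -l1E -l2E -l3E.
  by case: i => [[|[|[|//]]] hi].
set u := normc (a1 + Num.conj a2).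
(* At a time s > 0 the segment is in the domain as soon as s (u - 2 Re g + 2) < 2; [m0] makes every
   s = 1 / (m0 + i + 1) satisfy this. *)
have [m0 hm0] : exists m0 : nat, u - 2 * Re g + 2 < m0%:R.
  exists (Num.bound `|u - 2 * Re g + 2|).
  by rewrite (le_lt_trans (ler_norm _))// archi_boundP.
pose s (i : nat) : R := (m0 + i).+1%:R^-1.
have p0 : p = 0.
  apply: (@poly_eq0_infinite_roots _ p (fun i => (s i)%:C)).
    move=> i j /complexI /invr_inj /eqP; rewrite eqr_nat => /eqP [] /addnI //.
  move=> i; have s0 : 0 < s i by rewrite invr_gt0 ltr0n.
  have hs : normc ((s i)%:C * a1 + Num.conj ((s i)%:C * a2)) < 2 * Re (1 + (s i)%:C * (g - 1)).
    have -> : (s i)%:C * a1 + Num.conj ((s i)%:C * a2) = (s i)%:C * (a1 + Num.conj a2).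
      rewrite !conjE; case: (a1) => x y; case: (a2) => z t.
      by apply: complex_ext => /=; ring.
    rewrite Normc.normcM normc_real gtr0_norm// -/u.
    have -> : Re (1 + (s i)%:C * (g - 1)) = 1 + s i * (Re g - 1).
      by case: (g) => x y /=; ring.
    have : s i * (u - 2 * Re g + 2) < 1.
      rewrite -[ltRHS](@mulVf _ (m0 + i).+1%:R) ?pnatr_eq0//.
      rewrite ltr_pM2l// (lt_le_trans hm0)// ler_nat.
      by rewrite -addnS leq_addr.
    by lra.
  (* The discriminant does not involve the matrix size, so its nonvanishing is taken from size 1. *)
  have [_ ds] := gauss_integral_neq0 (n := 1) isT hs.
  apply/rootP; rewrite evE ?dE// hT ?mulr0//.
  exact/gauss_domainP.
have d1 : d.[1] = a1 * a2 - g ^+ 2.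
  by rewrite dE !mul1r; congr (_ - _ ^+ 2); ring.
have := evE 1; rewrite d1 => /(_ dn0); rewrite p0 horner0 !mul1r.
have -> : 1 + (g - 1) = g by ring.
move/esym/eqP; rewrite mulf_eq0 expf_eq0 (negbTE dn0) andbF /=.
by move/eqP.
Qed.

Lemma eval_over_deltaM (T S : mpoly.mpoly 3 C) (a1 a2 g : C) :
  eval_over_delta (T * S) a1 a2 g = eval_over_delta T a1 a2 g * eval_over_delta S a1 a2 g.
Proof. by rewrite /eval_over_delta mpoly.mevalM. Qed.

Lemma eval_over_deltaB (T S : mpoly.mpoly 3 C) (a1 a2 g : C) :
  eval_over_delta (T - S) a1 a2 g = eval_over_delta T a1 a2 g - eval_over_delta S a1 a2 g.
Proof. by rewrite /eval_over_delta mpoly.mevalB. Qed.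

(** Existence of one valid polynomial [T] makes the choice [gauss_polynomial F] valid instead of the
    default 0; two valid polynomials agree wherever delta is nonzero. *)
Lemma gauss_mean_polyE n (F : 'M[C]_n -> 'M[C]_n -> C) (T : mpoly.mpoly 3 C) :
  (forall a1 a2 g, gauss_domain a1 a2 g ->
     gauss_ratio F a1 a2 g = eval_over_delta T a1 a2 g) ->
  forall a1 a2 g, a1 * a2 - g ^+ 2 != 0 ->
    gauss_mean a1 a2 g F = eval_over_delta T a1 a2 g.
Proof.
move=> hT a1 a2 g dn0; rewrite /gauss_mean.
have hG : forall b1 b2 h, gauss_domain b1 b2 h ->
    gauss_ratio F b1 b2 h = eval_over_delta (gauss_polynomial F) b1 b2 h.
  exact: (@xgetPex _ (0 : mpoly.mpoly 3 C) [set P | forall a1 a2 g, gauss_domain a1 a2 g ->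
    gauss_ratio F a1 a2 g = eval_over_delta P a1 a2 g] (ex_intro _ T hT)).
apply/eqP; rewrite -subr_eq0 -eval_over_deltaB; apply/eqP.
apply: (eval_over_delta_ext0 (T := gauss_polynomial F - T)) dn0 => b1 b2 h hb.
by rewrite eval_over_deltaB -hG// -hT// subrr.
Qed.

Variable n : nat.
Hypothesis n_gt0 : (0 < n)%N.
Local Notation N := (n * n + n * n)%N.
Local Notation poly := (mpoly.mpoly N C).
Local Notation lin := (@lin R n).
Local Notation Zmx := (Zmx R n).
Local Notation Wmx := (Wmx R n).
Local Notation gauss_form := (@gauss_form R n).

Lemma mxtrace_comb3 (K : comNzRingType) k (c1 c2 c3 : K) (A1 A2 A3 : 'M[K]_k) :
  \tr (c1 *: A1 + c2 *: A2 + c3 *: A3) = c1 * \tr A1 + c2 * \tr A2 + c3 * \tr A3.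
Proof. by rewrite !mxtraceD !mxtraceZ. Qed.

Lemma gauss_weight_tuple (a1 a2 g : C) x :
  gauss_weight a1 a2 g (@mx_of_tuple R n x) = weight lin (gauss_form a1 a2 g) x.
Proof.
rewrite /gauss_weight /weight -evm_tuple evm_gauss_form !expr2.
exact: (f_equal (fun z => cexp (- z)) (mxtrace_comb3 _ _ _ _ _ _)).
Qed.

Lemma mx_integralE (a1 a2 g : C) (P : poly) :
  mx_integral (fun Z => evm Z (Z ^t*) P * gauss_weight a1 a2 g Z) =
  gint lin (gauss_form a1 a2 g) P.
Proof.
rewrite gint.unlock /mx_integral /cint.
by congr (_ +i* _); apply: eq_Rintegral => x _; rewrite gauss_weight_tuple evm_tuple.
Qed.

Lemma gauss_ratioE (a1 a2 g : C) (P : poly) :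
  gauss_ratio (fun A B => evm A B P) a1 a2 g =
  gint lin (gauss_form a1 a2 g) P / gint lin (gauss_form a1 a2 g) 1.
Proof.
rewrite /gauss_ratio mx_integralE; congr (_ / _).
rewrite -(mx_integralE a1 a2 g 1); congr mx_integral; apply/funext => Z.
by rewrite /evm mpoly.meval1 mul1r.
Qed.

Lemma gauss_domain_coercive (a1 a2 g : C) : gauss_domain a1 a2 g ->
  exists c, coercive lin c (gauss_form a1 a2 g).
Proof. by move=> /gauss_domainP h; eexists; exact: gauss_form_coercive. Qed.

(** Kept in product form, so that linearity and the induction on degree never divide by the
    normalization. *)
Definition has_moment (P : poly) (T : mpoly.mpoly 3 C) := forall a1 a2 g,
  gauss_domain a1 a2 g ->
  gint lin (gauss_form a1 a2 g) P =
  eval_over_delta T a1 a2 g * gint lin (gauss_form a1 a2 g) 1.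

Lemma has_moment_meanE P T : has_moment P T ->
  forall a1 a2 g, a1 * a2 - g ^+ 2 != 0 ->
    gauss_mean a1 a2 g (fun A B => evm A B P) = eval_over_delta T a1 a2 g.
Proof.
move=> hP; apply: gauss_mean_polyE => a1 a2 g hd; rewrite gauss_ratioE hP//.
have /gauss_domainP hu := hd; have [D0 _] := gauss_integral_neq0 n_gt0 hu.
by rewrite mulfK.
Qed.

Lemma has_momentD P Q T S : has_moment P T -> has_moment Q S ->
  has_moment (P + Q) (T + S).
Proof.
move=> hP hQ a1 a2 g hd; have [c cq] := gauss_domain_coercive hd.
by rewrite (gintD cq) hP// hQ// /eval_over_delta mpoly.mevalD mulrDl.
Qed.

Lemma has_momentZ (z : C) P T : has_moment P T -> has_moment (z *: P) (z *: T).
Proof.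
move=> hP a1 a2 g hd; have [c cq] := gauss_domain_coercive hd.
by rewrite (gintZ cq) hP// /eval_over_delta mpoly.mevalZ mulrA.
Qed.

Lemma has_moment0 : has_moment 0 0.
Proof.
move=> a1 a2 g hd; have [c cq] := gauss_domain_coercive hd.
by rewrite (gint0 cq) /eval_over_delta mpoly.meval0 mul0r.
Qed.

Lemma has_moment1 : has_moment 1 1.
Proof. by move=> a1 a2 g hd; rewrite /eval_over_delta mpoly.meval1 mul1r. Qed.

Let x1 : mpoly.mpoly 3 C := var (@Ordinal 3 0 isT).
Let x2 : mpoly.mpoly 3 C := var (@Ordinal 3 1 isT).
Let x3 : mpoly.mpoly 3 C := var (@Ordinal 3 2 isT).

Let eval_x (a1 a2 g : C) : let d := a1 * a2 - g ^+ 2 in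
  [/\ eval_over_delta x1 a1 a2 g = a1 / d, eval_over_delta x2 a1 a2 g = a2 / d &
      eval_over_delta x3 a1 a2 g = g / d].
Proof. by split; rewrite /eval_over_delta mpoly.mevalXU. Qed.

Lemma cramer2 (a b c x y u v : C) : a * b - c ^+ 2 != 0 ->
  a * x + c * y = u -> b * y + c * x = v -> 
  x = b / (a * b - c ^+ 2) * u - c / (a * b - c ^+ 2) * v.
Proof. by move=> d0 <- <-; field. Qed.

(** Cramer's rule for the two Schwinger-Dyson equations: its coefficients a2/delta and - g/delta are
    the values of [x2] and [- x3], so polynomiality is preserved. *)
Lemma has_moment_mulZ (P : poly) i j TZ TW :
  has_moment (mpoly.mderiv (iZ i j) P) TZ -> has_moment (mpoly.mderiv (iW i j) P) TW ->
  has_moment (P * Zmx j i) (x2 * TZ - x3 * TW).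
Proof.
move=> hZ hW a1 a2 g hd; have [c cq] := gauss_domain_coercive hd.
have /gauss_domainP hu := hd; have [_ d0] := gauss_integral_neq0 n_gt0 hu.
have [_ e2 e3] := eval_x a1 a2 g.
rewrite (cramer2 d0 (schwinger_dyson_Z cq i j P) (schwinger_dyson_W cq i j P)).
rewrite hZ// hW// eval_over_deltaB !eval_over_deltaM e2 e3.
by rewrite mulrBl !mulrA.
Qed.

Lemma has_moment_mulW (P : poly) i j TZ TW :
  has_moment (mpoly.mderiv (iZ i j) P) TZ -> has_moment (mpoly.mderiv (iW i j) P) TW ->
  has_moment (P * Wmx j i) (x1 * TW - x3 * TZ).
Proof.
move=> hZ hW a1 a2 g hd; have [c cq] := gauss_domain_coercive hd.
have /gauss_domainP hu := hd; have [_ d0] := gauss_integral_neq0 n_gt0 hu.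
(* The two equations are taken in the opposite order, so delta is written as a2 a1 - g^2. *)
have [e1 _ e3] := eval_x a1 a2 g; rewrite (mulrC a1) in d0 e1 e3.
rewrite (cramer2 d0 (schwinger_dyson_W cq i j P) (schwinger_dyson_Z cq i j P)).
rewrite hZ// hW// eval_over_deltaB !eval_over_deltaM e1 e3.
by rewrite mulrBl !mulrA.
Qed.

Lemma has_moment_monomial (m : mpoly.multinom N) : exists T, has_moment (mpoly.mpolyX C m) T.
Proof.
have [k] := ubnP (mpoly.mdeg m); elim: k m => // k IH m mk.
have [m0|m0] := eqVneq m mpoly.mnm0.
  by exists 1; rewrite m0 mpoly.mpolyX0; exact: has_moment1.
have [a ma] : exists a, (0 < mpoly.fun_of_multinom m a)%N.
  apply/existsP; apply: contraNT m0; rewrite negb_exists => /forallP h.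
  apply/eqP/mpoly.mnmP => a; rewrite mpoly.mnm0E.
  by apply/eqP; rewrite -leqn0 leqNgt.
pose m' := mpoly.mnm_sub m (mpoly.mnm1 a).
have mE : m = mpoly.mnm_add m' (mpoly.mnm1 a).
  apply/mpoly.mnmP => b; rewrite mpoly.mnmDE mpoly.mnmBE mpoly.mnm1E subnK//.
  by case: eqP => // <-.
have m'k : (mpoly.mdeg m' < k)%N.
  by move: mk; rewrite mE mpoly.mdegD mpoly.mdeg1 addn1 ltnS.
have dm b : exists T, has_moment (mpoly.mderiv b (mpoly.mpolyX C m')) T.
  (* If the variable [b] is absent from [m'], the truncated subtraction returns [m'] itself; its
     degree is still below [k], and the scalar in front of it is 0. *)
  have [|T hT] := IH (mpoly.mnm_sub m' (mpoly.mnm1 b)).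
    by rewrite (leq_ltn_trans _ m'k)// mpoly.mdegB.
  by rewrite mpoly.mderivX; eexists; exact: has_momentZ hT.
rewrite mE mpoly.mpolyXD; case: (splitP a) => p ap.
  case/mxvec_indexP: p ap => i j ap; have -> : a = iZ i j by apply/val_inj.
  (* Indices are swapped: multiplication by Z_ij is governed by the derivatives in Z_ji and W_ji. *)
  have [TZ hZ] := dm (iZ j i); have [TW hW] := dm (iW j i).
  by rewrite -ZmxE; eexists; exact: has_moment_mulZ hZ hW.
case/mxvec_indexP: p ap => i j ap; have -> : a = iW j i by apply/val_inj.
have [TZ hZ] := dm (iZ i j); have [TW hW] := dm (iW i j).
by rewrite -WmxE; eexists; exact: has_moment_mulW hZ hW.
Qed.

Lemma has_moment_ex (P : poly) : exists T, has_moment P T.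
Proof.
rewrite (mpoly.mpolyE P); elim: (mpoly.msupp P) => [|m r [T hT]].
  by exists 0; rewrite big_nil; exact: has_moment0.
have [S hS] := has_moment_monomial m; rewrite big_cons.
by eexists; apply: has_momentD hT; exact: has_momentZ hS.
Qed.

Section mean.
Variables a1 a2 g : C.
Hypothesis d0 : a1 * a2 - g ^+ 2 != 0.

Definition gmean (P : poly) : C := gauss_mean a1 a2 g (fun A B => evm A B P).

Lemma gmeanD P Q : gmean (P + Q) = gmean P + gmean Q.
Proof.
have [T hT] := has_moment_ex P; have [S hS] := has_moment_ex Q.
rewrite /gmean (has_moment_meanE hT d0) (has_moment_meanE hS d0).
by rewrite (has_moment_meanE (has_momentD hT hS) d0) /eval_over_delta mpoly.mevalD.
Qed.

Lemma gmean0 : gmean 0 = 0.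
Proof. by rewrite /gmean (has_moment_meanE has_moment0 d0) /eval_over_delta mpoly.meval0. Qed.

Lemma gmean_sum (I : Type) (r : seq I) (F : I -> poly) :
  gmean (\sum_(i <- r) F i) = \sum_(i <- r) gmean (F i).
Proof.
elim: r => [|i r IH]; first by rewrite !big_nil gmean0.
by rewrite !big_cons gmeanD IH.
Qed.

(** Transfers an equation from the domain to all nonzero delta. The coefficients [a] and [h] are not
    polynomials in the quotients by delta, but a / delta is the value of [y] and h / delta that of
    [x3]. *)
Let mean_combination (y : mpoly.mpoly 3 C) (a : C -> C -> C -> C) (P1 P2 P3 : poly) :
  (forall b1 b2 h, eval_over_delta y b1 b2 h = a b1 b2 h / (b1 * b2 - h ^+ 2)) ->
  (forall b1 b2 h, gauss_domain b1 b2 h -> let q := gauss_form b1 b2 h in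
    a b1 b2 h * gint lin q P1 + h * gint lin q P2 = gint lin q P3) ->
  a a1 a2 g * gmean P1 + g * gmean P2 = gmean P3.
Proof.
move=> ya hP.
have [T1 h1] := has_moment_ex P1; have [T2 h2] := has_moment_ex P2.
have [T3 h3] := has_moment_ex P3.
rewrite /gmean (has_moment_meanE h1 d0) (has_moment_meanE h2 d0) (has_moment_meanE h3 d0).
(* [x1 * x2 - x3 * x3] evaluates to 1 / delta, so [S] is the defect of the equation divided by
   delta. *)
pose S := (x1 * x2 - x3 * x3) * T3 - (y * T1 - - (x3 * T2)).
have SE b1 b2 h : b1 * b2 - h ^+ 2 != 0 ->
    eval_over_delta S b1 b2 h * (b1 * b2 - h ^+ 2) = eval_over_delta T3 b1 b2 h -
     (a b1 b2 h * eval_over_delta T1 b1 b2 h + h * eval_over_delta T2 b1 b2 h).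
  have [e1 e2 e3] := eval_x b1 b2 h.
  have eN : eval_over_delta (- (x3 * T2)) b1 b2 h = - eval_over_delta (x3 * T2) b1 b2 h.
    by rewrite /eval_over_delta mpoly.mevalN.
  rewrite /S eval_over_deltaB eval_over_deltaM !eval_over_deltaB eN !eval_over_deltaM e1 e2 e3 ya opprK => dn.
  move: (eval_over_delta T1 _ _ _) (eval_over_delta T2 _ _ _) (eval_over_delta T3 _ _ _) (a _ _ _) dn.
  by move=> t1 t2 t3 w dn; field.
suff S0 : eval_over_delta S a1 a2 g = 0.
  by have := SE _ _ _ d0; rewrite S0 mul0r => /esym/eqP; rewrite subr_eq0 => /eqP ->.
apply: (eval_over_delta_ext0 (T := S)) d0 => b1 b2 h hb.
have /gauss_domainP hu := hb; have [D0 dn] := gauss_integral_neq0 n_gt0 hu.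
apply: (mulIf dn); rewrite SE// mul0r; apply/eqP; rewrite subr_eq0; apply/eqP.
apply: (mulIf D0); rewrite mulrDl -!mulrA -h1// -h2// -h3//.
by rewrite hP.
Qed.

Lemma gmean_loop_Z (P : poly) (F : 'M[poly]_n) :
  a1 * gmean (P * \tr (Zmx * F)) + g * gmean (P * \tr (Wmx * F)) =
  gmean (\sum_i \sum_j mpoly.mderiv (iZ i j) (P * F i j)).
Proof.
apply: (mean_combination (y := x1) (a := fun b1 _ _ => b1)) => [b1 b2 h|b1 b2 h hb q].
  by have [] := eval_x b1 b2 h.
by have [c cq] := gauss_domain_coercive hb; exact: (schwinger_dyson_tr_Z cq).
Qed.

Lemma gmean_loop_W (P : poly) (F : 'M[poly]_n) :
  a2 * gmean (P * \tr (Wmx * F)) + g * gmean (P * \tr (Zmx * F)) =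
  gmean (\sum_i \sum_j mpoly.mderiv (iW i j) (P * F i j)).
Proof.
apply: (mean_combination (y := x2) (a := fun _ b2 _ => b2)) => [b1 b2 h|b1 b2 h hb q].
  by have [] := eval_x b1 b2 h.
by have [c cq] := gauss_domain_coercive hb; exact: (schwinger_dyson_tr_W cq).
Qed.

End mean.

End gauss_mean_theory.

(** * Divergence of products of traces of words, and evaluation of the results *)

Section word_divergence.
Variables (K : comNzRingType) (n : nat) (D : 'I_n -> 'I_n -> K -> K).
Hypothesis D_add : forall i j, {morph D i j : x y / x + y}.
Hypothesis D_mul : forall i j x y, D i j (x * y) = D i j x * y + x * D i j y.
Variables (A B : 'M[K]_n) (p : nat) (len : nat -> nat) (k l : nat -> nat -> nat).

Let f t := word (k t) (l t) 1 (len t).+1 A B.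
Let pre t r := word (k t) (l t) 1 r A B.
Let suf t r := word (k t) (l t) r.+1 (len t).+1 A B.
Let G0 := \prod_(1 <= u < p.+1) \tr (f u).
Let G t := \prod_(1 <= u < p.+1 | u != t) \tr (f u).

Let derivation_mxX_null (X : 'M[K]_n) m i j :
  map_mx (D i j) X = 0 -> map_mx (D i j) (X ^+ m) = 0.
Proof.
move=> h; rewrite (derivation_mxX (@D_add i j) (@D_mul i j)) h.
by rewrite big1// => s _; rewrite mulr0 mul0r.
Qed.

(** Since [B] is constant for [D], only the letters [A] contribute; letter [j] of block [r] cuts the
    word into [pre * A ^+ j] and the rest. *)
Lemma word_divergence_left :
  (forall i j, map_mx (D i j) A = delta_mx i j) -> (forall i j, map_mx (D i j) B = 0) ->
  \sum_i \sum_j D i j (G0 * f 0%N i j) =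
  \sum_(1 <= r < (len 0%N).+1) \sum_(0 <= j < k 0%N r)
     G0 * \tr (pre 0%N r * A ^+ j) * \tr (A ^+ (k 0%N r - j - 1) * B ^+ l 0%N r * suf 0%N r)
  + \sum_(1 <= t < p.+1) \sum_(1 <= r < (len t).+1) \sum_(0 <= j < k t r)
     G t * \tr (pre t r * A ^+ j * f 0%N * A ^+ (k t r - j - 1) * B ^+ l t r * suf t r).
Proof.
move=> DA DB; rewrite (@divergence_word_product _ _ _ D_add D_mul p f len k
  (fun t r j => pre t r * A ^+ j) (fun t r j => A ^+ (k t r - j - 1) * B ^+ l t r * suf t r)).
  congr (_ + _); apply: eq_bigr => t _; apply: eq_bigr => r _; apply: eq_bigr => j _.
  by rewrite !mulrA.
move=> t i j; rewrite (derivation_word (@D_add i j) (@D_mul i j))//.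
apply: eq_bigr => r _.
rewrite (derivation_mxM (@D_add i j) (@D_mul i j)) (derivation_mxX_null (l t r) (DB i j)) mulr0 addr0.
rewrite (derivation_mxX (@D_add i j) (@D_mul i j)) DA !(mulr_suml, mulr_sumr).
by apply: eq_bigr => s _; rewrite !mulrA.
Qed.

Lemma word_divergence_right :
  (forall i j, map_mx (D i j) A = 0) -> (forall i j, map_mx (D i j) B = delta_mx i j) ->
  \sum_i \sum_j D i j (G0 * f 0%N i j) =
  \sum_(1 <= r < (len 0%N).+1) \sum_(0 <= j < l 0%N r)
     G0 * \tr (pre 0%N r * A ^+ k 0%N r * B ^+ j) * \tr (B ^+ (l 0%N r - j - 1) * suf 0%N r)
  + \sum_(1 <= t < p.+1) \sum_(1 <= r < (len t).+1) \sum_(0 <= j < l t r)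
     G t * \tr (pre t r * A ^+ k t r * B ^+ j * f 0%N * B ^+ (l t r - j - 1) * suf t r).
Proof.
move=> DA DB; rewrite (@divergence_word_product _ _ _ D_add D_mul p f len l
  (fun t r j => pre t r * A ^+ k t r * B ^+ j) (fun t r j => B ^+ (l t r - j - 1) * suf t r)).
  congr (_ + _); apply: eq_bigr => t _; apply: eq_bigr => r _; apply: eq_bigr => j _.
  by rewrite !mulrA.
move=> t i j; rewrite (derivation_word (@D_add i j) (@D_mul i j))//.
apply: eq_bigr => r _.
rewrite (derivation_mxM (@D_add i j) (@D_mul i j)) (derivation_mxX_null (k t r) (DA i j)) mul0r add0r.
rewrite (derivation_mxX (@D_add i j) (@D_mul i j)) DB !(mulr_suml, mulr_sumr).
by apply: eq_bigr => s _; rewrite !mulrA.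
Qed.

End word_divergence.

Section word_morphism.
Variables (K A : comNzRingType) (phi : {rmorphism A -> K}) (n : nat).
Variables (Z W : 'M[A]_n) (X Y : 'M[K]_n).
Hypotheses (phiZ : map_mx phi Z = X) (phiW : map_mx phi W = Y).

Lemma map_mxM_ring (P Q : 'M[A]_n) :
  map_mx phi (P * Q) = map_mx phi P * map_mx phi Q.
Proof. exact: map_mxM. Qed.

Lemma map_mxX_ring (P : 'M[A]_n) k : map_mx phi (P ^+ k) = map_mx phi P ^+ k.
Proof.
elim: k => [|k IH]; last by rewrite !exprS map_mxM_ring IH.
by rewrite !expr0; exact: map_mx1.
Qed.

Lemma map_word k l a b : map_mx phi (word k l a b Z W) = word k l a b X Y.
Proof.
rewrite /word (big_morph (map_mx phi) map_mxM_ring (map_mx1 phi n)).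
by apply: eq_bigr => u _; rewrite map_mxM_ring !map_mxX_ring phiZ phiW.
Qed.

Lemma morph_tr (P : 'M[A]_n) : phi (\tr P) = \tr (map_mx phi P).
Proof. by rewrite trace_map_mx. Qed.

Lemma morph_prod_tr_word (I : Type) (r : seq I) (P : pred I) k l a (b : I -> nat) :
  phi (\prod_(u <- r | P u) \tr (word (k u) (l u) a (b u) Z W)) =
  \prod_(u <- r | P u) \tr (word (k u) (l u) a (b u) X Y).
Proof.
by rewrite rmorph_prod; apply: eq_bigr => u _; rewrite morph_tr map_word.
Qed.

Local Notation w k l a b := (word k l a b Z W).
Local Notation w' k l a b := (word k l a b X Y).
Variables (I : Type) (r : seq I) (P : pred I) (k l : I -> nat -> nat) (b : I -> nat).
Local Notation G := (\prod_(u <- r | P u) \tr (w (k u) (l u) 1 (b u))).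
Local Notation G' := (\prod_(u <- r | P u) \tr (w' (k u) (l u) 1 (b u))).
Implicit Types (c d : nat -> nat) (a e i j m q : nat).

Lemma morph_lhs_left c d a e :
  phi (G * \tr (Z * w c d a e)) = G' * \tr (X * w' c d a e).
Proof. by rewrite rmorphM morph_prod_tr_word morph_tr map_mxM_ring map_word phiZ. Qed.

Lemma morph_lhs_right c d a e :
  phi (G * \tr (W * w c d a e)) = G' * \tr (Y * w' c d a e).
Proof. by rewrite rmorphM morph_prod_tr_word morph_tr map_mxM_ring map_word phiW. Qed.

Lemma morph_split_left c d a e j m q i :
  phi (G * \tr (w c d 1 a * Z ^+ j) * \tr (Z ^+ m * W ^+ q * w c d i e)) =
  G' * \tr (w' c d 1 a * X ^+ j) * \tr (X ^+ m * Y ^+ q * w' c d i e).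
Proof.
by rewrite !rmorphM morph_prod_tr_word !morph_tr !map_mxM_ring !map_word !map_mxX_ring phiZ phiW.
Qed.

Lemma morph_split_right c d a e j m q i :
  phi (G * \tr (w c d 1 a * Z ^+ j * W ^+ q) * \tr (W ^+ m * w c d i e)) =
  G' * \tr (w' c d 1 a * X ^+ j * Y ^+ q) * \tr (Y ^+ m * w' c d i e).
Proof.
by rewrite !rmorphM morph_prod_tr_word !morph_tr !map_mxM_ring !map_word !map_mxX_ring phiZ phiW.
Qed.

Lemma morph_join_left c d c0 d0 a e e0 j m q i :
  phi (G * \tr (w c d 1 a * Z ^+ j * w c0 d0 1 e0 * Z ^+ m * W ^+ q * w c d i e)) =
  G' * \tr (w' c d 1 a * X ^+ j * w' c0 d0 1 e0 * X ^+ m * Y ^+ q * w' c d i e).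
Proof.
by rewrite rmorphM morph_prod_tr_word morph_tr !map_mxM_ring !map_word !map_mxX_ring phiZ phiW.
Qed.

Lemma morph_join_right c d c0 d0 a e e0 j m q i :
  phi (G * \tr (w c d 1 a * Z ^+ j * W ^+ q * w c0 d0 1 e0 * W ^+ m * w c d i e)) =
  G' * \tr (w' c d 1 a * X ^+ j * Y ^+ q * w' c0 d0 1 e0 * Y ^+ m * w' c d i e).
Proof.
by rewrite rmorphM morph_prod_tr_word morph_tr !map_mxM_ring !map_word !map_mxX_ring phiZ phiW.
Qed.

End word_morphism.

Section gmean_extensional.
Context {R : realType} (n : nat).
Local Notation C := R[i].

Lemma gmeanE (a1 a2 g : C) (F : 'M[C]_n -> 'M[C]_n -> C) P :
  (forall A B, evm A B P = F A B) -> gmean a1 a2 g P = gauss_mean a1 a2 g F.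
Proof.
move=> h; rewrite /gmean; congr gauss_mean.
by apply/funext => A; apply/funext => B.
Qed.

End gmean_extensional.
Theorem theorem3p2 (R : realType) (n : nat) (n_gt0 : (0 < n)%N)
    (a1 a2 g : R[i]) (delta_neq0 : a1 * a2 - g ^+ 2 != 0)
    (p : nat) (len : nat -> nat) (k l : nat -> nat -> nat) :
  let f t (A B : 'M[R[i]]_n) := word (k t) (l t) 1 (len t).+1 A B in
  let pre t r (A B : 'M[R[i]]_n) := word (k t) (l t) 1 r A B in
  let suf t r (A B : 'M[R[i]]_n) := word (k t) (l t) r.+1 (len t).+1 A B in
  let G0 (A B : 'M[R[i]]_n) := \prod_(1 <= u < p.+1) \tr (f u A B) in
  let G t (A B : 'M[R[i]]_n) := \prod_(1 <= u < p.+1 | u != t) \tr (f u A B) in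
  (a1 * gauss_mean a1 a2 g (fun A B => G0 A B * \tr (A * f 0%N A B))
     + g * gauss_mean a1 a2 g (fun A B => G0 A B * \tr (B * f 0%N A B))
   = \sum_(1 <= r < (len 0%N).+1) \sum_(0 <= j < k 0%N r)
       gauss_mean a1 a2 g (fun A B =>
         G0 A B * \tr (pre 0%N r A B * A ^+ j)
         * \tr (A ^+ (k 0%N r - j - 1) * B ^+ l 0%N r * suf 0%N r A B))
     + \sum_(1 <= t < p.+1) \sum_(1 <= r < (len t).+1) \sum_(0 <= j < k t r)
         gauss_mean a1 a2 g (fun A B =>
           G t A B * \tr (pre t r A B * A ^+ j * f 0%N A B
                          * A ^+ (k t r - j - 1) * B ^+ l t r * suf t r A B)))
  /\
  (a2 * gauss_mean a1 a2 g (fun A B => G0 A B * \tr (B * f 0%N A B))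
     + g * gauss_mean a1 a2 g (fun A B => G0 A B * \tr (A * f 0%N A B))
   = \sum_(1 <= r < (len 0%N).+1) \sum_(0 <= j < l 0%N r)
       gauss_mean a1 a2 g (fun A B =>
         G0 A B * \tr (pre 0%N r A B * A ^+ k 0%N r * B ^+ j)
         * \tr (B ^+ (l 0%N r - j - 1) * suf 0%N r A B))
     + \sum_(1 <= t < p.+1) \sum_(1 <= r < (len t).+1) \sum_(0 <= j < l t r)
         gauss_mean a1 a2 g (fun A B =>
           G t A B * \tr (pre t r A B * A ^+ k t r * B ^+ j * f 0%N A B
                          * B ^+ (l t r - j - 1) * suf t r A B))).
Proof.
move=> f pre suf G0 G.
pose Z := Zmx R n; pose W := Wmx R n.
(* Functions and polynomials are matched under an arbitrary ring morphism sending [Z], [W] to [A],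
   [B]; evaluation at the pair is one such morphism. *)
have mean F P : (forall (A B : 'M[R[i]]_n)
    (phi : {rmorphism mpoly.mpoly (n * n + n * n) R[i] -> R[i]}),
    map_mx phi Z = A -> map_mx phi W = B -> phi P = F A B) ->
    gauss_mean a1 a2 g F = gmean a1 a2 g P.
  move=> h; apply/esym/gmeanE => A B.
  by apply: (h A B (mpoly.meval _)); [exact: evm_Zmx|exact: evm_Wmx].
have Dadd v : {morph (mpoly.mderiv v : mpoly.mpoly (n * n + n * n) R[i] -> _) : x y / x + y}.
  exact: mpoly.mderivD.
have Dmul v (x y : mpoly.mpoly (n * n + n * n) R[i]) :
    mpoly.mderiv v (x * y) = mpoly.mderiv v x * y + x * mpoly.mderiv v y.
  exact: mpoly.mderivM.
split.
(* The loop equation with P the product of the traces of f_1, ..., f_p and F = f_0. *)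
- have E := gmean_loop_Z n_gt0 delta_neq0
    (\prod_(1 <= u < p.+1) \tr (word (k u) (l u) 1 (len u).+1 Z W))
    (word (k 0%N) (l 0%N) 1 (len 0%N).+1 Z W).
  rewrite (word_divergence_left (fun i j => Dadd (iZ i j)) (fun i j => Dmul (iZ i j))
    p len k l (@mderiv_Zmx R n) (@mderiv_Z_Wmx R n)) in E.
  rewrite (gmeanD n_gt0 delta_neq0) !(gmean_sum n_gt0 delta_neq0) in E.
  apply: (etrans _ (etrans E _)).
    apply: (f_equal2 (fun x y => a1 * x + g * y)); apply: mean => A B phi hZ hW.
      exact: (morph_lhs_left hZ hW).
    exact: (morph_lhs_right hZ hW).
  (* In the splitting sum [t] and [r] stand for the block and the position; the joining sum has one
     more level, the word. *)
  congr (_ + _); apply: eq_bigr => t _; rewrite (gmean_sum n_gt0 delta_neq0);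
    apply: eq_bigr => r _.
    by apply/esym/mean => A B phi hZ hW; exact: (morph_split_left hZ hW).
  rewrite (gmean_sum n_gt0 delta_neq0); apply: eq_bigr => j _.
  by apply/esym/mean => A B phi hZ hW; exact: (morph_join_left hZ hW).
- have E := gmean_loop_W n_gt0 delta_neq0
    (\prod_(1 <= u < p.+1) \tr (word (k u) (l u) 1 (len u).+1 Z W))
    (word (k 0%N) (l 0%N) 1 (len 0%N).+1 Z W).
  rewrite (word_divergence_right (fun i j => Dadd (iW i j)) (fun i j => Dmul (iW i j))
    p len k l (@mderiv_W_Zmx R n) (@mderiv_Wmx R n)) in E.
  rewrite (gmeanD n_gt0 delta_neq0) !(gmean_sum n_gt0 delta_neq0) in E.
  apply: (etrans _ (etrans E _)).
    apply: (f_equal2 (fun x y => a2 * x + g * y)); apply: mean => A B phi hZ hW.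
      exact: (morph_lhs_right hZ hW).
    exact: (morph_lhs_left hZ hW).
  congr (_ + _); apply: eq_bigr => t _; rewrite (gmean_sum n_gt0 delta_neq0);
    apply: eq_bigr => r _.
    by apply/esym/mean => A B phi hZ hW; exact: (morph_split_right hZ hW).
  rewrite (gmean_sum n_gt0 delta_neq0); apply: eq_bigr => j _.
  by apply/esym/mean => A B phi hZ hW; exact: (morph_join_right hZ hW).
Qed.
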